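(* Let $n\ge1$ be an integer, $s\in(0,1)$ with $n>2s$, let $\Omega\subset\mathbb{R}^n$ be a bounded Lipschitz domain, and let $2_s^*:=\frac{2n}{n-2s}$. (i) For every $\varepsilon\in(0,1-s)$ one has the continuous inclusions $$\mathcal{H}^{s+\varepsilon}_0(\Omega)\subset\mathcal{H}^{s+\mathrm{Log}}_0(\Omega)\subset\mathcal{H}^s_0(\Omega).$$ (ii) The embedding $\mathcal{H}^{s+\mathrm{Log}}_0(\Omega)\hookrightarrow L^p(\Omega)$ is compact for every $p\in[1,2_s^*]$.
   Context: Functions are real-valued. For $\sigma\in(0,1)$, $\mathcal{H}^\sigma_0(\Omega)$ is the Hilbert space of measurable $u:\mathbb{R}^n\to\mathbb{R}$ with $u\equiv0$ on $\mathbb{R}^n\setminus\Omega$ and $\|u\|_{\mathcal{H}^\sigma_0(\Omega)}:=\Bigl(\iint_{\mathbb{R}^n\times\mathbb{R}^n}\frac{(u(x)-u(y))^2}{|x-y|^{n+2\sigma}}dx\,dy\Bigr)^{1/2}<\infty$. With $a_+:=\max\{0,a\}$, $c_{n,s}=2^{2s}\pi^{-n/2}s\frac{\Gamma((n+2s)/2)}{\Gamma(1-s)}$ and $\mathbf{k}_{s+\mathrm{Log},+}(z):=c_{n,s}|z|^{-n-2s}(-\ln|z|)_+$, put $[u]_{s+\mathrm{Log},+}^2:=\iint_{\mathbb{R}^n\times\mathbb{R}^n}(u(x)-u(y))^2\mathbf{k}_{s+\mathrm{Log},+}(x-y)\,dx\,dy$; then $\mathcal{H}^{s+\mathrm{Log}}_0(\Omega):=\{u\in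 L^2(\mathbb{R}^n):[u]_{s+\mathrm{Log},+}<\infty,\ u=0\text{ a.e. in }\Omega^c\}$ with norm $\|u\|_{\mathcal{H}^{s+\mathrm{Log}}_0(\Omega)}:=[u]_{s+\mathrm{Log},+}$. *)

(* Defs.v *)
From HB Require Import structures.
From mathcomp Require Import all_boot all_order all_algebra.
From mathcomp Require Import all_classical all_reals all_analysis.
Set Implicit Arguments.
Unset Strict Implicit.
Unset Printing Implicit Defensive.
Import Order.TTheory GRing.Theory Num.Theory.
Import numFieldNormedType.Exports.
Local Open Scope classical_set_scope.
Local Open Scope ring_scope.

(* R^n is 'rV[R]_n, with the topology of the library. Its sigma-algebra is the
   one generated by the coordinates, as the library does for n.-tuple; it is the
   Borel sigma-algebra. *)
Definition measure_rV_display : measure_display -> measure_display.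
Proof. exact. Qed.

Section measurable_rV.
Context {d} {T : measurableType d} (n : nat).

Let coors : 'I_n -> 'rV[T]_n -> T := fun i x => x ord0 i.

Let rV_set0 : g_sigma_preimage coors set0.
Proof. exact: sigma_algebra0. Qed.

Let rV_setC A : g_sigma_preimage coors A -> g_sigma_preimage coors (~` A).
Proof. exact: sigma_algebraC. Qed.

Let rV_bigcup (F : _^nat) : (forall i, g_sigma_preimage coors (F i)) ->
  g_sigma_preimage coors (\bigcup_i (F i)).
Proof. exact: sigma_algebra_bigcup. Qed.

HB.instance Definition _ := @isMeasurable.Build (measure_rV_display d)
  'rV[T]_n (g_sigma_preimage coors) rV_set0 rV_setC rV_bigcup.

Lemma measurable_coord (i : 'I_n) :
  measurable_fun [set: 'rV[T]_n] (fun x : 'rV[T]_n => x ord0 i).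
Proof.
move=> _ Y mY; rewrite setTI; apply: sub_sigma_algebra => /=.
rewrite -bigcup_seq/=; exists i => /=; first by rewrite mem_index_enum.
by exists Y => //; rewrite setTI.
Qed.

Lemma measurable_fun_rVP d1 (T1 : measurableType d1) (f : T1 -> 'rV[T]_n) :
  (forall i, measurable_fun [set: T1] (fun x => f x ord0 i)) ->
  measurable_fun [set: T1] f.
Proof.
move=> mf _ Y; rewrite setTI.
move: Y; apply: smallest_sub.
  split=> [|A|A]; first by rewrite /= preimage_set0; exact: measurable0.
  - by move=> mA; rewrite setTD /= preimage_setC; exact: measurableC.
  - by move=> mA; rewrite /= preimage_bigcup; exact: bigcupT_measurable.
move=> A; rewrite -bigcup_seq/= => -[i _ [B mB <-]].
by have := mf i measurableT B mB; rewrite !setTI.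
Qed.

End measurable_rV.

Section lebesgue_rV.
Context {R : realType}.

Definition rVcons n (p : R * 'rV[R]_n) : 'rV[R]_n.+1 :=
  row_mx (const_mx p.1 : 'rV[R]_1) p.2.

Definition rVuncons n (x : 'rV[R]_n.+1) : R * 'rV[R]_n :=
  (x ord0 ord0, rsubmx (x : 'rV[R]_(1 + n))).

Let rVcons0 n (p : R * 'rV[R]_n) : rVcons p ord0 ord0 = p.1.
Proof.
rewrite (_ : ord0 = lshift n (ord0 : 'I_1)); last exact/val_inj.
by rewrite /rVcons (row_mxEl (const_mx p.1 : 'rV[R]_1)) mxE.
Qed.

Let rVconsS n (p : R * 'rV[R]_n) (i : 'I_n) :
  rVcons p ord0 (lift ord0 i) = p.2 ord0 i.
Proof.
rewrite -(row_mxEr (const_mx p.1 : 'rV[R]_1) p.2 ord0 i).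
by congr (rVcons p _ _); exact/val_inj.
Qed.

Lemma rVconsK n : cancel (@rVcons n) (@rVuncons n).
Proof. by move=> [a y]; rewrite /rVuncons rVcons0 row_mxKr. Qed.

Lemma rVunconsK n : cancel (@rVuncons n) (@rVcons n).
Proof.
move=> x; apply/rowP => j; case: (unliftP ord0 j) => [i ->|->]; last first.
  by rewrite rVcons0.
by rewrite rVconsS /= mxE; congr (x _ _); exact/val_inj.
Qed.

Lemma measurable_rVcons n : measurable_fun setT (@rVcons n).
Proof.
apply: measurable_fun_rVP => j; case: (unliftP ord0 j) => [i ->|->]; last first.
  by under eq_fun do rewrite rVcons0; exact: measurable_fst.
under eq_fun do rewrite rVconsS.
exact: (measurableT_comp (measurable_coord i) measurable_snd).
Qed.

Lemma measurable_rVuncons n : measurable_fun setT (@rVuncons n).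
Proof.
apply/measurable_fun_pairP; split; first exact: measurable_coord.
apply: measurable_fun_rVP => i /=.
by under eq_fun do rewrite mxE; exact: measurable_coord.
Qed.

Section step.
Variables (n : nat) (mu : {sigma_finite_measure set 'rV[R]_n -> \bar R}).

Let push : set 'rV[R]_n.+1 -> \bar R :=
  pushforward (@lebesgue_measure R \x mu)%E (@rVcons n).

Let push0 : push set0 = 0%E.
Proof. by rewrite /push /pushforward preimage_set0 measure0. Qed.

Let push_ge0 A : (0 <= push A)%E.
Proof. exact: (@measure_ge0 _ _ _ (@lebesgue_measure R \x mu)%E). Qed.

Let push_sigma_additive : semi_sigma_additive push.
Proof.
move=> F mF tF mUF; rewrite /push /pushforward preimage_bigcup.
have mc A : measurable A -> measurable (@rVcons n @^-1` A).
  by move=> mA; rewrite -[X in measurable X]setTI; exact: measurable_rVcons.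
apply: (@measure_semi_sigma_additive _ _ _ (@lebesgue_measure R \x mu)%E).
- by move=> k; exact: mc.
- apply/trivIsetP => /= i j _ _ ij; rewrite -preimage_setI.
  by move/trivIsetP : tF => /(_ _ _ _ _ ij) ->//; rewrite preimage_set0.
- by rewrite -preimage_bigcup; exact: mc.
Qed.

HB.instance Definition _ := isMeasure.Build _ _ _ push
  push0 push_ge0 push_sigma_additive.

Let push_sigma_finite : sigma_finite setT push.
Proof.
have [F TF Foo] : sigma_finite setT (@lebesgue_measure R \x mu)%E.
  have /sigma_finiteP[F [TF ndF Foo]] := sigma_finiteT (@lebesgue_measure R).
  have /sigma_finiteP[G [TG ndG Goo]] := sigma_finiteT mu.
  exists (fun k => F k `*` G k).
    rewrite -setXTT TF TG predeqE => -[x y]; split.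
      move=> [/= [i _ Fix] [k _ Gky]]; exists (maxn i k) => //; split.
      - by move: x Fix; exact/subsetPset/ndF/leq_maxl.
      - by move: y Gky; exact/subsetPset/ndG/leq_maxr.
    by move=> [i _ []/= ? ?]; split; exists i.
  move=> k; have [? ?] := Foo k; have [? ?] := Goo k.
  split; first exact: measurableX.
  by rewrite product_measure1E// lte_mul_pinfty// ge0_fin_numE.
exists (fun k => @rVuncons n @^-1` F k).
  by rewrite -preimage_bigcup -TF preimage_setT.
move=> k; have [mF Fk] := Foo k; split.
  by rewrite -[X in measurable X]setTI; exact: measurable_rVuncons.
rewrite /push /pushforward -comp_preimage.
by rewrite (_ : _ \o _ = id) ?preimage_id//; apply/funext/rVconsK.
Qed.

HB.instance Definition _ :=
  Measure_isSigmaFinite.Build _ _ _ push push_sigma_finite.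

(* image of dx (x) mu under R x R^n = R^(n+1) *)
Definition lebesgue_rVS : {sigma_finite_measure set 'rV[R]_n.+1 -> \bar R} :=
  push.

End step.

Fixpoint lebesgue_rV n : {sigma_finite_measure set 'rV[R]_n -> \bar R} :=
  if n is m.+1 then lebesgue_rVS (lebesgue_rV m) else @dirac _ 'rV[R]_0 0 R.

Lemma lebesgue_rVSE n (A : set 'rV[R]_n.+1) :
  lebesgue_rV n.+1 A = (@lebesgue_measure R \x lebesgue_rV n)%E (@rVcons n @^-1` A).
Proof. by []. Qed.

End lebesgue_rV.
Arguments lebesgue_rV R n : clear implicits.

Section domains.
Context {R : realType}.

Definition enorm n (x : 'rV[R]_n) : R := Num.sqrt (\sum_(i < n) x ord0 i ^+ 2).

(* Near every boundary point, after an orthogonal change of coordinates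
   y = x *m Q, the set is the part lying strictly above the graph of a Lipschitz
   function of the coordinates of y other than the i-th. *)
Definition lipschitz_boundary n (Omega : set 'rV[R]_n) : Prop :=
  forall x0, (closure Omega `\` interior Omega) x0 ->
  exists (r : R) (Q : 'M[R]_n) (i : 'I_n) (gamma : 'rV[R]_n.-1 -> R) (L : R),
  [/\ 0 < r, Q *m Q^T = 1%:M,
      forall y z, `|gamma y - gamma z| <= L * enorm (y - z) &
      forall x, enorm (x - x0) < r ->
        Omega x <-> gamma (col' i (x *m Q)) < (x *m Q) ord0 i].

Definition bounded_lipschitz_domain n (Omega : set 'rV[R]_n) : Prop :=
  [/\ Omega !=set0, open Omega, connected Omega, bounded_set Omega &
      lipschitz_boundary Omega].

End domains.

(* Elements are functions; equality almost everywhere is not quotiented out, so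
   all membership conditions below are invariant under it. *)
Record normed_fspace (R : realType) (T : Type) := NormedFSpace {
  fcarrier : set (T -> R) ;
  fnorm : (T -> R) -> \bar R }.

Section embeddings.
Context {R : realType} {T : Type}.
Implicit Types X Y : normed_fspace R T.

Definition continuously_included X Y : Prop :=
  fcarrier X `<=` fcarrier Y /\
  exists C : R, forall u, fcarrier X u -> (fnorm Y u <= C%:E * fnorm X u)%E.

(* bounded sequences of X have subsequences converging in Y *)
Definition compactly_embedded X Y : Prop :=
  continuously_included X Y /\
  forall u_ : (T -> R)^nat, (forall k, fcarrier X (u_ k)) ->
  (exists M : R, forall k, (fnorm X (u_ k) <= M%:E)%E) ->
  exists phi : nat -> nat, {homo phi : i j / (i < j)%N} /\
  exists2 v, fcarrier Y v & fnorm Y (fun x => u_ (phi k) x - v x) @[k --> \oo] --> 0%E.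

End embeddings.

Section spaces.
Context {R : realType}.

Definition Gamma (t : R) : R :=
  \int[lebesgue_measure]_(x in `]0, +oo[) (x `^ (t - 1) * expR (- x)).

Definition cns (n : nat) (s : R) : R :=
  2 `^ (2 * s) * pi `^ (- (n%:R / 2)) * s *
  (Gamma ((n%:R + 2 * s) / 2) / Gamma (1 - s)).

Definition kenergy n (k : 'rV[R]_n -> R) (u : 'rV[R]_n -> R) : \bar R :=
  \int[(lebesgue_rV R n \x lebesgue_rV R n)%E]_z
    ((u z.1 - u z.2) ^+ 2 * k (z.1 - z.2))%:E.

(* The values of the kernels at z = 0 (here 0) only matter on the diagonal, which
   is a null set, and where u z.1 - u z.2 = 0 anyway. *)
Definition kernel_frac n (sigma : R) (z : 'rV[R]_n) : R :=
  (enorm z `^ (n%:R + 2 * sigma))^-1.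

Definition kernel_log n (s : R) (z : 'rV[R]_n) : R :=
  cns n s * enorm z `^ (- n%:R - 2 * s) * Num.max 0 (- ln (enorm z)).

Definition norm_frac n sigma (u : 'rV[R]_n -> R) : \bar R :=
  (kenergy (kernel_frac sigma) u `^ 2^-1)%E.

Definition norm_log n s (u : 'rV[R]_n -> R) : \bar R :=
  (kenergy (kernel_log s) u `^ 2^-1)%E.

(* Vanishing outside Omega is meant almost everywhere: the elements of both
   spaces are classes of functions modulo equality almost everywhere. *)
Definition zero_outside n (Omega : set 'rV[R]_n) (u : 'rV[R]_n -> R) : Prop :=
  {ae lebesgue_rV R n, forall x, ~ Omega x -> u x = 0}.

Definition H_frac n (sigma : R) (Omega : set 'rV[R]_n) :=
  NormedFSpace
    [set u | [/\ measurable_fun setT u, zero_outside Omega u &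
                 (norm_frac sigma u < +oo)%E]]
    (norm_frac sigma).

Definition H_log n (s : R) (Omega : set 'rV[R]_n) :=
  NormedFSpace
    [set u | [/\ u \in Lfun (lebesgue_rV R n) 2%:E, (norm_log s u < +oo)%E &
                 zero_outside Omega u]]
    (norm_log s).

(* L^p(Omega), for functions on R^n, only sees the restriction to Omega (here
   extended by zero), so inclusion in it is the embedding u |-> u|_Omega. *)
Definition Lp_on n (p : R) (Omega : set 'rV[R]_n) :=
  NormedFSpace
    [set u : 'rV[R]_n -> R | u \_ Omega \in Lfun (lebesgue_rV R n) p%:E]
    (fun u => 'N[lebesgue_rV R n]_p%:E[EFin \o (u \_ Omega)]%E).

End spaces.

(* Main.v *)
Require Import Defs.
From mathcomp Require Import all_boot all_order all_algebra.
From mathcomp Require Import all_classical all_reals all_analysis.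
From mathcomp Require Import measurable_realfun.
From mathcomp Require Import ring lra.
Import Order.TTheory GRing.Theory Num.Theory.
Import numFieldNormedType.Exports.
Set Implicit Arguments.
Unset Strict Implicit.
Unset Printing Implicit Defensive.
Local Open Scope classical_set_scope.
Local Open Scope ring_scope.

(** Write [q = 2 n / (n - 2 s)] for the critical exponent, [E_s] and [E_log] for
    the two energies, [c] for the constant [cns n s].

    Inclusions. Pointwise, [- ln |z|] is at most [|z| ^ (- 2 eps) / (2 eps)], so
    [E_log] is at most a multiple of [E_(s + eps)]. Conversely, for every [L > 0],
    on [|z| < exp (- L)] the fractional kernel is at most [1 / (c L)] times the
    logarithmic one, and the part of [E_s] carried by [|z| >= exp (- L)] is at
    most a multiple of [int u ^ 2], because the tail of [|z| ^ (- n - 2 s)] is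
    integrable; hence (kenergy_frac_le_log)

      E_s u <= 1 / (c L) * E_log u + C_L * int u ^ 2.

    As [u] vanishes outside a bounded set, [int u ^ 2] is in turn at most a multiple
    of [E_log u] (poincare). The logarithmic kernel lives on the unit ball, which
    may be much smaller than the domain, so this is done by walking out of the
    domain along a chain of small adjacent cubes.

    Sobolev inequality. [u] is compared with its values on a cube about [x] whose
    size depends on [u x] (sobolev_pointwise). With [I = int |u| ^ q] this yields
    [|u x| ^ q <= C * I ^ (2 s / n) * int_y (u x - u y) ^ 2 * |x - y| ^ (- n - 2 s)],
    and after integration [I ^ (2 / q) <= C * E_s u], first for truncations of [u],
    for which [I] is finite, then in general (sobolev).

    Compactness. Let [u_k] vanish outside the domain, with bounded [E_log]. Then
    [E_s] is bounded, and the [u_k] are close in mean square to step functions on a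
    fine grid, so they are precompact in [L ^ 2] (mean_square_precompact). For a
    difference [w = u_k - u_l], the displayed inequality bounds [E_s w]: the first
    term is small as soon as [L] is large, uniformly in [k] and [l]; with [L] fixed,
    the second is small along a subsequence. By the Sobolev inequality [w] is small
    in [L ^ q], critical exponent included (critical_precompact): here the logarithm
    is what makes the difference. A diagonal subsequence is Cauchy in [L ^ q], it
    converges there (fast_cauchy_limit), and the domain having finite measure, it
    converges in [L ^ p] for all [p <= q] (Lnorm_le). *)

(** * Integrals of nonnegative real functions *)
Section nonnegative_integrals.
Context d (T : measurableType d) (R : realType).
Variable mu : {measure set T -> \bar R}.
Implicit Types (f g h : T -> R) (A B D : set T).

Lemma le_integral_EFin D f g : measurable D ->
  measurable_fun setT f -> measurable_fun setT g ->
  (forall x, 0 <= f x) -> (forall x, D x -> f x <= g x) ->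
  (\int[mu]_(x in D) (f x)%:E <= \int[mu]_(x in D) (g x)%:E)%E.
Proof.
move=> mD mf mg f0 fg; apply: ge0_le_integral => //.
- by move=> x _; rewrite lee_fin.
- by apply/measurable_EFinP; exact: measurable_funTS.
- by apply/measurable_EFinP; exact: measurable_funTS.
Qed.

Lemma integral_EFin_lin D (a b : R) f g : measurable D -> 0 <= a -> 0 <= b ->
  measurable_fun setT f -> measurable_fun setT g ->
  (forall x, 0 <= f x) -> (forall x, 0 <= g x) ->
  (\int[mu]_(x in D) (a * f x + b * g x)%:E =
   a%:E * \int[mu]_(x in D) (f x)%:E + b%:E * \int[mu]_(x in D) (g x)%:E)%E.
Proof.
move=> mD a0 b0 mf mg f0 g0.
have mf' : measurable_fun D (EFin \o f) by apply/measurable_EFinP; exact: measurable_funTS.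
have mg' : measurable_fun D (EFin \o g) by apply/measurable_EFinP; exact: measurable_funTS.
under eq_integral do rewrite EFinD (EFinM a) (EFinM b).
rewrite ge0_integralD//.
- rewrite !ge0_integralZl//; by move=> x _; rewrite lee_fin.
- by move=> x _; rewrite mule_ge0 ?lee_fin.
- exact: measurable_funeM.
- by move=> x _; rewrite mule_ge0 ?lee_fin.
- exact: measurable_funeM.
Qed.

Lemma le_integral_lin D (a b : R) f g h : measurable D -> 0 <= a -> 0 <= b ->
  measurable_fun setT f -> measurable_fun setT g -> measurable_fun setT h ->
  (forall x, 0 <= f x) -> (forall x, 0 <= g x) -> (forall x, 0 <= h x) ->
  (forall x, D x -> f x <= a * g x + b * h x) ->
  (\int[mu]_(x in D) (f x)%:E <=
   a%:E * \int[mu]_(x in D) (g x)%:E + b%:E * \int[mu]_(x in D) (h x)%:E)%E.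
Proof.
move=> mD a0 b0 mf mg mh f0 g0 h0 fgh; rewrite -integral_EFin_lin//.
apply: le_integral_EFin => //.
by apply: measurable_funD; apply: measurable_funM.
Qed.

Lemma integral_EFinZ D (a : R) f : measurable D -> 0 <= a ->
  measurable_fun setT f -> (forall x, 0 <= f x) ->
  (\int[mu]_(x in D) (a * f x)%:E = a%:E * \int[mu]_(x in D) (f x)%:E)%E.
Proof.
move=> mD a0 mf f0; under eq_integral do rewrite EFinM.
rewrite ge0_integralZl//; last by move=> x _; rewrite lee_fin.
by apply/measurable_EFinP; exact: measurable_funTS.
Qed.

Lemma le_integralZ D (a : R) f g : measurable D -> 0 <= a ->
  measurable_fun setT f -> measurable_fun setT g ->
  (forall x, 0 <= f x) -> (forall x, 0 <= g x) ->
  (forall x, D x -> f x <= a * g x) ->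
  (\int[mu]_(x in D) (f x)%:E <= a%:E * \int[mu]_(x in D) (g x)%:E)%E.
Proof.
move=> mD a0 mf mg f0 g0 fg; rewrite -integral_EFinZ//.
by apply: le_integral_EFin => //; apply: measurable_funM.
Qed.

Lemma subset_integral_EFin A B f : measurable A -> measurable B ->
  measurable_fun setT f -> (forall x, 0 <= f x) -> A `<=` B ->
  (\int[mu]_(x in A) (f x)%:E <= \int[mu]_(x in B) (f x)%:E)%E.
Proof.
move=> mA mB mf f0 AB; apply: ge0_subset_integral => //.
- by apply/measurable_EFinP; exact: measurable_funTS.
- by move=> x _; rewrite lee_fin.
Qed.

Lemma integral_cst_EFin D (c v : R) : measurable D -> mu D = v%:E ->
  (\int[mu]_(x in D) c%:E = (c * v)%:E)%E.
Proof. by move=> mD muD; rewrite [LHS](integral_cst mu mD) muD. Qed.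

Lemma measurable_normr_powR f (p : R) : measurable_fun setT f ->
  measurable_fun setT (fun x => `|f x| `^ p).
Proof.
move=> mf; apply: (measurableT_comp (measurable_powR _)).
exact: (measurableT_comp (@normr_measurable R setT)).
Qed.

End nonnegative_integrals.

(** * Euclidean norm and cubes *)
Section euclidean.
Context {R : realType} (n : nat).
Implicit Types x y z : 'rV[R]_n.

Lemma enorm_ge0 x : 0 <= enorm x. Proof. exact: sqrtr_ge0. Qed.

Lemma enormN x : enorm (- x) = enorm x.
Proof.
by congr Num.sqrt; apply: eq_bigr => i _; rewrite mxE sqrrN.
Qed.

Lemma enormB x y : enorm (x - y) = enorm (y - x).
Proof. by rewrite -enormN opprB. Qed.

Lemma coord_le_enorm x i : `|x ord0 i| <= enorm x.
Proof.
rewrite -sqrtr_sqr ler_wsqrtr// (bigD1 i)//= lerDl.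
by apply: sumr_ge0 => j _; exact: sqr_ge0.
Qed.

Lemma enorm_le_coord x (l : R) : 0 <= l -> (forall i, `|x ord0 i| <= l) ->
  enorm x <= n%:R * l.
Proof.
move=> l0 xl.
suff: enorm x <= Num.sqrt ((n%:R * l) ^+ 2).
  by rewrite sqrtr_sqr ger0_norm// mulr_ge0.
apply: ler_wsqrtr; apply: (@le_trans _ _ (\sum_(i < n) l ^+ 2)).
  apply: ler_sum => i _; rewrite -[x ord0 i ^+ 2]real_normK ?num_real//.
  by rewrite lerXn2r// nnegrE.
rewrite sumr_const card_ord exprMn -[_ *+ n]mulr_natl ler_wpM2r ?sqr_ge0//.
by rewrite -natrX ler_nat; case: (n) => // m; rewrite leq_pmulr.
Qed.

Lemma enorm_eq0 x : enorm x = 0 -> x = 0.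
Proof.
move=> x0; apply/rowP => i; rewrite mxE; apply/eqP.
by rewrite -normr_le0 -x0 coord_le_enorm.
Qed.

Lemma measurable_enorm : measurable_fun setT (@enorm R n).
Proof.
apply: (@measurableT_comp _ _ _ _ _ _ (@Num.sqrt R)).
  by apply: continuous_measurable_fun; exact: sqrt_continuous.
by apply: measurable_sum => i; apply: measurable_funX; exact: measurable_coord.
Qed.

Lemma measurable_rVB : measurable_fun setT (fun z : 'rV[R]_n * 'rV[R]_n => z.1 - z.2).
Proof.
apply: measurable_fun_rVP => i.
rewrite (_ : (fun _ => _) = (fun z : 'rV[R]_n * 'rV[R]_n => z.1 ord0 i - z.2 ord0 i)).
  by apply: measurable_funB;
    apply: (measurableT_comp (measurable_coord i));
    [exact: measurable_fst|exact: measurable_snd].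
by apply/funext => z; rewrite !mxE.
Qed.

End euclidean.

Section cubes.
Context {R : realType}.

(** Half-open, so that translates along a grid are disjoint. *)
Definition cube n (a : 'rV[R]_n) (l : R) : set 'rV[R]_n :=
  [set y | forall i, a ord0 i <= y ord0 i < a ord0 i + l].

Lemma measurable_cube n (a : 'rV[R]_n) l : measurable (cube a l).
Proof.
rewrite (_ : cube a l = \big[setI/setT]_(i < n)
    ((fun y : 'rV[R]_n => y ord0 i) @^-1` `[a ord0 i, a ord0 i + l[%classic)).
  apply: bigsetI_measurable => i _; rewrite -[X in measurable X]setTI.
  exact: measurable_coord.
rewrite -bigcap_seq; apply/seteqP; split => y /= Hy i.
  by move=> _ /=; rewrite in_itv/=; exact: Hy.
by have /= := Hy i (mem_index_enum _); rewrite in_itv.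
Qed.

Lemma lebesgue_cube n (a : 'rV[R]_n) l : 0 <= l ->
  lebesgue_rV R n (cube a l) = (l ^+ n)%:E.
Proof.
move=> l0; elim: n a => [|n IH] a.
  rewrite (_ : cube a l = setT); last by apply/seteqP; split => // y _ [].
  by rewrite expr0 /= diracE in_setT.
rewrite lebesgue_rVSE.
rewrite (_ : _ @^-1` _ = `[a ord0 ord0, a ord0 ord0 + l[%classic `*`
    cube (\row_i a ord0 (lift ord0 i)) l).
  rewrite product_measure1E//; last exact: measurable_cube.
  rewrite IH [X in (X * _)%E](_ : _ = l%:E) -?EFinM ?exprS//.
  rewrite [LHS]lebesgue_measure_itv/= lte_fin ltrDl.
  have [l_gt0|l_le0] := ltrP 0 l; first by rewrite -EFinD addrAC subrr add0r.
  by congr EFin; apply/eqP; rewrite eq_le l0.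
have rV0 p : rVcons p ord0 ord0 = p.1 :> R.
  by rewrite -[in RHS](rVconsK p).
have rVS p i : rVcons p ord0 (lift ord0 i) = p.2 ord0 i :> R.
  by rewrite -[in RHS](rVconsK p) /rVuncons [RHS]mxE; congr (rVcons p _ _); exact/val_inj.
apply/seteqP; split => -[x y] /= H.
  split => /=; first by have := H ord0; rewrite rV0 in_itv/=.
  by move=> i; rewrite mxE -(rVS _ (x, y)); exact: H.
case: H => /= Hx Hy i; case: (unliftP ord0 i) => [j ->|->].
  by have := Hy j; rewrite mxE -(rVS _ (x, y)).
by rewrite rV0; rewrite in_itv/= in Hx.
Qed.

End cubes.

Section cube_geometry.
Context {R : realType}.

Lemma cube_diam n (a x y : 'rV[R]_n) l : cube a l x -> cube a l y ->
  enorm (x - y) <= n%:R * l.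
Proof.
case: n a x y => [|n] a x y Hx Hy.
  by rewrite /enorm big_ord0 sqrtr0 mul0r.
apply: enorm_le_coord => [|i]; first by have := Hx ord0; lra.
by rewrite !mxE ler_norml; have := Hx i; have := Hy i; lra.
Qed.

(** The cube of centre [x] and side [2 r]: it contains the open Euclidean ball of
    radius [r], and lies in the closed one of radius [n r]. *)
Definition ccube n (x : 'rV[R]_n) (r : R) := cube (x - const_mx r) (2 * r).

Lemma enorm_lt_ccube n (x y : 'rV[R]_n) r : enorm (x - y) < r -> ccube x r y.
Proof.
move=> xyr i; have := le_lt_trans (coord_le_enorm (x - y) i) xyr.
by rewrite !mxE ltr_norml; lra.
Qed.

Lemma ccube_enorm_le n (x y : 'rV[R]_n) r : 0 <= r -> ccube x r y ->
  enorm (x - y) <= n%:R * r.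
Proof.
move=> r0 Hy; apply: enorm_le_coord => // i.
by rewrite !mxE ler_norml; have := Hy i; rewrite !mxE; lra.
Qed.

Lemma measurable_ccube n (x : 'rV[R]_n) r : measurable (ccube x r).
Proof. exact: measurable_cube. Qed.

Lemma lebesgue_ccube n (x : 'rV[R]_n) r : 0 <= r ->
  lebesgue_rV R n (ccube x r) = ((2 * r) ^+ n)%:E.
Proof. by move=> r0; rewrite lebesgue_cube// mulr_ge0. Qed.

Lemma integral_indic_ccube n (x : 'rV[R]_n) r : 0 <= r ->
  (\int[lebesgue_rV R n]_y (\1_(ccube x r) y)%:E = ((2 * r) ^+ n)%:E)%E.
Proof.
move=> r0; rewrite integral_indic//; last exact: measurable_ccube.
by rewrite setIT; exact: lebesgue_ccube.
Qed.

(** An open set is the union of the cubes of mesh [1 / k.+1] with vertices in the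
    corresponding lattice which it contains. *)
Lemma open_measurable_rV n (U : set 'rV[R]_n) : open U -> measurable U.
Proof.
move=> oU.
pose Q (c : nat * 'rV[int]_n) : set 'rV[R]_n :=
  cube (map_mx (fun m : int => m%:~R / c.1.+1%:R) c.2) c.1.+1%:R^-1.
pose F c := if `[< Q c `<=` U >] then Q c else set0.
rewrite (_ : U = \bigcup_c F c).
  apply: countable_bigcupT_measurable => [|c]; first exact: countableP.
  rewrite /F.
  by case: ifPn => _; [exact: measurable_cube|exact: measurable0].
apply/seteqP; split => [x Ux|x [c _]]; last first.
  by rewrite /F; case: asboolP => // + Qx; exact.
have /nbhs_ballP[e /= e0 xeU] : nbhs x U by exact: open_nbhs_nbhs.
have [k ke] : exists k : nat, k.+1%:R^-1 < e.
  exists (Num.truncn e^-1); rewrite invf_plt ?posrE//.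
  exact: truncnS_gt.
have k0 : 0 < k.+1%:R :> R by rewrite ltr0n.
pose m := map_mx (fun t : R => Num.floor (t * k.+1%:R)) x.
have Qx : Q (k, m) x.
  move=> i; rewrite !mxE /= -[X in _ < _ + X]mul1r -mulrDl ler_pdivrMr//.
  rewrite ltr_pdivlMr//.
  by have := floor_itv (x ord0 i * k.+1%:R); rewrite intrD.
exists (k, m) => //; rewrite /F; case: asboolP => [//|[]] y Qy.
apply: xeU; split => // j i; rewrite (ord1 j) /ball /= ltr_norml.
have /= := Qx i; have /= := Qy i; move: ke.
set t := _^-1; set b := map_mx _ _ _ _.
by move: (x ord0 i) (y ord0 i) b => xi yi b; lra.
Qed.

End cube_geometry.

(** * Dyadic sums *)
Section dyadic.
Context {R : realType}.

Lemma dyadic_lt (r : R) : 1 <= r -> exists j : nat, 2 ^+ j <= r < 2 ^+ j.+1.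
Proof.
move=> r1; have ex : exists j : nat, r < 2 ^+ j.
  exists (Num.truncn r).+1; rewrite (lt_le_trans (truncnS_gt r))//.
  by rewrite -natrX ler_nat ltnW// ltn_expl.
case: (ex_minnP ex) => -[|j] rj jmin; first by rewrite expr0 ltNge r1 in rj.
exists j; rewrite rj andbT leNgt; apply/negP => /jmin.
by rewrite ltnn.
Qed.

Lemma nneseries_geometric_le (f : nat -> \bar R) (a q : R) : 0 <= a ->
  0 <= q < 1 -> (forall j, 0 <= f j)%E -> (forall j, f j <= (a * q ^+ j)%:E)%E ->
  (\sum_(j <oo) f j <= (a / (1 - q))%:E)%E.
Proof.
move=> a0 /andP[q0 q1] f0 fq; apply: lime_le.
  by apply: is_cvg_nneseries => j _.
apply: nearW => N; apply: (@le_trans _ _ (\sum_(0 <= j < N) (a * q ^+ j)%:E)%E).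
  by apply: lee_sum => j _.
rewrite sumEFin lee_fin -mulr_sumr ler_wpM2l//.
have q10 : 0 < 1 - q by rewrite subr_gt0.
rewrite -[leRHS]mul1r ler_pdivlMr// big_mkord.
have := subrX1 q N; have := exprn_ge0 N q0.
set S := \sum_(i < N) _; set t := q ^+ N => ? ?; nra.
Qed.

Lemma le_nneseries (f : nat -> \bar R) j : (forall i, 0 <= f i)%E ->
  (f j <= \sum_(i <oo) f i)%E.
Proof.
move=> f0; rewrite (@nneseriesD1 _ _ j)//.
by rewrite leeDl//; apply: nneseries_ge0.
Qed.

End dyadic.

(** * Tail of the fractional kernel *)
Section tail.
Context {R : realType} (n : nat).

Lemma measurable_kernel_frac sigma : measurable_fun setT (@kernel_frac R n sigma).
Proof.
apply: (eq_measurable_fun (fun z => enorm z `^ (- (n%:R + 2 * sigma)))).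
  by move=> z _; rewrite powRN.
exact: (measurableT_comp (measurable_powR _) (@measurable_enorm _ _)).
Qed.

Lemma measurable_rVBl (x : 'rV[R]_n) : measurable_fun setT (fun y : 'rV[R]_n => x - y).
Proof.
apply: measurable_fun_rVP => i; under eq_fun do rewrite !mxE.
by apply: measurable_funB => //; exact: measurable_coord.
Qed.

Lemma measurable_enorm_ge (r : R) : measurable [set z : 'rV[R]_n | r <= enorm z].
Proof.
rewrite (_ : [set _ | _] = @enorm R n @^-1` `[r, +oo[%classic).
  by rewrite -[X in measurable X]setTI; exact: measurable_enorm.
by apply/seteqP; split => z /=; rewrite in_itv/= andbT.
Qed.

Definition far_kernel (sigma delta : R) (z : 'rV[R]_n) : R :=
  \1_[set z | delta <= enorm z] z * kernel_frac sigma z.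

Lemma far_kernel_ge0 sigma delta z : 0 <= far_kernel sigma delta z.
Proof. by rewrite mulr_ge0// invr_ge0 powR_ge0. Qed.

Lemma measurable_far_kernel sigma delta :
  measurable_fun setT (far_kernel sigma delta).
Proof.
apply: measurable_funM; last exact: measurable_kernel_frac.
by apply: measurable_indic; exact: measurable_enorm_ge.
Qed.

(** The shell [2 ^ j * delta <= |x - y| < 2 ^ j.+1 * delta] lies in a cube of
    volume comparable to [(2 ^ j * delta) ^ n], so it contributes a multiple of
    [2 ^ (- 2 sigma j)]: a geometric series. *)
Lemma tail_kernel_frac (sigma delta : R) : 0 < sigma -> 0 < delta ->
  exists2 C : R, 0 <= C & forall x : 'rV[R]_n,
  (\int[lebesgue_rV R n]_y
     (far_kernel sigma delta (x - y))%:E <= C%:E)%E.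
Proof.
move=> sigma0 delta0; pose q : R := 2 `^ (- (2 * sigma)).
pose a : R := 4 ^+ n * delta `^ (- (2 * sigma)).
have a0 : 0 <= a by rewrite mulr_ge0 ?exprn_ge0 ?powR_ge0.
have q0 : 0 <= q by exact: powR_ge0.
have q1 : q < 1.
  rewrite /q powRN invf_lt1 ?powR_gt0//.
  have {1}-> : 1 = 1 `^ (2 * sigma) :> R by rewrite powR1.
  by apply: gt0_ltr_powR; rewrite ?nnegrE ?mulr_gt0// ltr1n.
exists (a / (1 - q)) => [|x]; first by rewrite divr_ge0// subr_ge0 ltW.
pose rho j : R := 2 ^+ j * delta.
have rho0 j : 0 < rho j by rewrite mulr_gt0// exprn_gt0.
pose c j : R := rho j `^ (- (n%:R + 2 * sigma)).
have c0 j : 0 <= c j by exact: powR_ge0.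
pose g j (y : 'rV[R]_n) : R := c j * \1_(ccube x (rho j.+1)) y.
have g0 j y : 0 <= g j y by rewrite mulr_ge0.
have mg j : measurable_fun setT (g j).
  by apply: measurable_funM => //; apply: measurable_indic; exact: measurable_ccube.
apply: (@le_trans _ _ (\int[lebesgue_rV R n]_y \sum_(j <oo) (g j y)%:E)%E).
  apply: ge0_le_integral => //.
  - by move=> y _; rewrite lee_fin far_kernel_ge0.
  - apply/measurable_EFinP.
    exact: (measurableT_comp (measurable_far_kernel _ _) (measurable_rVBl x)).
  - apply: ge0_emeasurable_sum => j; first by move=> y _ _; rewrite lee_fin.
    by move=> _; apply/measurable_EFinP.
  - move=> y _; rewrite /far_kernel indicE; case: (boolP (_ \in _)) => [|_]; last first.
      by rewrite mul0r; apply: nneseries_ge0 => j _ _; rewrite lee_fin.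
    rewrite inE/= mul1r => xy.
    have [|j /andP[j1 j2]] := @dyadic_lt R (enorm (x - y) / delta).
      by rewrite ler_pdivlMr ?mul1r.
    rewrite ler_pdivlMr// in j1; rewrite ltr_pdivrMr// in j2.
    apply: (@le_trans _ _ (g j y)%:E).
      rewrite lee_fin /g indicE mem_set ?mulr1; last exact: enorm_lt_ccube.
      rewrite /kernel_frac /c powRN lef_pV2 ?posrE ?powR_gt0//.
        apply: ge0_ler_powR; rewrite ?nnegrE ?enorm_ge0// ?(ltW (rho0 _))//.
        by rewrite addr_ge0// mulr_ge0// ltW.
      exact: lt_le_trans xy.
    by apply: (le_nneseries (f := fun j => (g j y)%:E)) => i; rewrite lee_fin.
rewrite integral_nneseries//; last 2 first.
  - by move=> j; apply/measurable_EFinP.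
  - by move=> j y _; rewrite lee_fin.
apply: nneseries_geometric_le => //; first by rewrite q0.
  by move=> j; apply: integral_ge0 => y _; rewrite lee_fin.
move=> j; rewrite /g integral_EFinZ//; last first.
  by apply: measurable_indic; exact: measurable_ccube.
rewrite (integral_indic_ccube _ (ltW (rho0 _))) -EFinM lee_fin.
have -> : 2 * rho j.+1 = 4 * rho j by rewrite /rho exprS; ring.
rewrite exprMn /c opprD powRD; last by rewrite (gt_eqF (rho0 j)) implybT.
rewrite powR_invn; last exact: ltW.

have -> : rho j `^ (- (2 * sigma)) = q ^+ j * delta `^ (- (2 * sigma)).
  rewrite /rho powRM ?exprn_ge0 ?(ltW delta0)//; congr (_ * _).
  by rewrite -powR_mulrn// powRAC powR_mulrn.
rewrite /a le_eqVlt; apply/orP; left; apply/eqP; field.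
by rewrite expf_neq0// gt_eqF.
Qed.
End tail.

(** * Positivity of the normalizing constant *)
Section gamma.
Context {R : realType}.
Local Notation mu := (@lebesgue_measure R).

Definition gamma_integrand (t x : R) : R := x `^ (t - 1) * expR (- x).

Lemma gamma_integrand_ge0 t x : 0 <= gamma_integrand t x.
Proof. by rewrite mulr_ge0 ?powR_ge0 ?expR_ge0. Qed.

Lemma measurable_gamma_integrand t : measurable_fun setT (gamma_integrand t).
Proof.
apply: measurable_funM; first exact: measurable_powR.
by apply: (measurableT_comp (@measurable_expR R)); exact: oppr_measurable.
Qed.

(** On a dyadic interval [x = theta * 2 ^ (- j)] with [theta] between [1/2] and [1];
    the first factor bounds [theta ^ (t - 1)] whatever the sign of [t - 1]. *)
Lemma gamma_integrand_le_near0 t x j : 2 ^+ j <= x^-1 < 2 ^+ j.+1 -> 0 < x ->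
  gamma_integrand t x <= (1 + 2^-1 `^ (t - 1)) * (2 ^+ j)^-1 `^ (t - 1).
Proof.
move=> /andP[j1 j2] x0; have p0 : 0 < 2 ^+ j :> R by rewrite exprn_gt0.
have xn0 : x != 0 by rewrite gt_eqF.
have pn0 : 2 ^+ j != 0 :> R by rewrite gt_eqF.
rewrite (@le_trans _ _ (x `^ (t - 1)))//.
  by rewrite /gamma_integrand ler_piMr ?powR_ge0 ?expR_le1 ?oppr_le0 ?(ltW x0).
have th1 : x * 2 ^+ j <= 1.
  by rewrite -[leRHS](mulfV xn0) ler_wpM2l ?(ltW x0).
have th2 : 2^-1 <= x * 2 ^+ j.
  have : x * x^-1 < x * 2 ^+ j.+1 by rewrite ltr_pM2l.
  by rewrite mulfV// exprS; lra.
have th0 : 0 < x * 2 ^+ j by exact: mulr_gt0.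
rewrite -[in leLHS](mulfK pn0 x) powRM ?invr_ge0 ?(ltW th0) ?(ltW p0)//.
rewrite ler_wpM2r ?powR_ge0//; have [t1|t1] := lerP 0 (t - 1).
  rewrite (@le_trans _ _ 1) ?lerDl ?powR_ge0//.
  rewrite -[leRHS](powRr0 (x * 2 ^+ j)).
  by apply: ger_powR; rewrite ?th0.
apply: ler_wpDl => //; rewrite -(opprK (t - 1)) powRN [leRHS]powRN.
rewrite lef_pV2 ?posrE ?powR_gt0//.
by apply: ge0_ler_powR; rewrite ?nnegrE ?oppr_ge0 ?(ltW t1)// ltW.
Qed.

(** The exponential beats [x ^ (t + 1)], leaving a decay like [x ^ (- 2)]. *)
Lemma gamma_integrand_le_nearoo t : exists2 K : R, 0 <= K & forall x j,
  2 ^+ j <= x -> gamma_integrand t x <= K * (4 ^+ j)^-1.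
Proof.
pose N := Num.truncn (t + 1); exists (N.+1)`!%:R => // x j xj.
have x1 : 1 <= x by apply: le_trans xj; rewrite exprn_ege1// ler1n.
have x0 : 0 < x by exact: lt_le_trans x1.
have xN : x `^ (t + 1) <= N.+1`!%:R * expR x.
  rewrite (@le_trans _ _ (x `^ N.+1%:R))//.
    by apply: ler_powR => //; exact/ltW/truncnS_gt.
  rewrite powR_mulrn ?(ltW x0)// -ler_pdivrMl ?ltr0n ?fact_gt0// mulrC.
  by rewrite (le_trans _ (expR_ge1Dxn N (ltW x0)))// lerDr.
rewrite /gamma_integrand expRN ler_pdivrMr ?expR_gt0//.
have -> : t - 1 = t + 1 - 2 by lra.
rewrite powRB ?(gt_eqF x0) ?implybT// ler_pdivrMr ?powR_gt0//.
apply: (le_trans xN); rewrite -!mulrA ler_wpM2l// mulrCA ler_peMr ?expR_ge0//.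
rewrite powR_mulrn ?(ltW x0)// mulrC ler_pdivlMr ?exprn_gt0// mul1r.
have -> : 4 ^+ j = (2 ^+ j) ^+ 2 :> R by rewrite -exprM mulnC exprM; congr (_ ^+ _); rewrite -natrX.
by rewrite lerXn2r ?nnegrE ?exprn_ge0// ltW.
Qed.

(** [Gamma] is the real number underlying an extended integral, hence [0] if that
    integral is infinite: positivity amounts to finiteness. Near [0] and near infinity the
    integrand is dominated by sums over dyadic intervals, which are geometric. *)
Lemma Gamma_gt0 (t : R) : 0 < t -> 0 < Gamma t.
Proof.
move=> t0; have -> : Gamma t =
    fine (\int[mu]_(x in `]0%R, +oo[) (gamma_integrand t x)%:E) by [].
apply: fine_gt0; apply/andP; split.
  have c0 : 0 < 2^-1 * expR (- 2) :> R by rewrite mulr_gt0 ?expR_gt0.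
  apply: (@lt_le_trans _ _ (\int[mu]_(x in `[1%R, 2%R]) (2^-1 * expR (- 2))%:E)%E).
    rewrite integral_cst// [X in (_ * X)%E](_ : _ = 1%:E) ?mule1 ?lte_fin//.
    rewrite [LHS]lebesgue_measure_itv/= lte_fin ltr1n/= -EFinD.
    by congr EFin; lra.
  apply: (@le_trans _ _ (\int[mu]_(x in `[1%R, 2%R]) (gamma_integrand t x)%:E)%E).
    apply: le_integral_EFin => //.
      exact: measurable_gamma_integrand.
    move=> x /=; rewrite in_itv/= => /andP[x1 x2].
    have x0 : 0 < x by exact: lt_le_trans x1.
    apply: ler_pM; rewrite ?expR_ge0 ?ler_expR//; last by lra.
    rewrite (@le_trans _ _ (x `^ (- 1)))//; last by apply: ler_powR => //; lra.
    by rewrite powR_inv1 ?(ltW x0)// lef_pV2// posrE.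
  apply: (@subset_integral_EFin _ _ R mu `[1%R, 2%R] `]0%R, +oo[ (gamma_integrand t)) => //.
  - exact: measurable_gamma_integrand.
  - exact: gamma_integrand_ge0.
  by move=> x /=; rewrite !in_itv/= andbT => /andP[+ _]; exact: lt_le_trans.
have [K' K'0 HK'] := gamma_integrand_le_nearoo t.
pose K : R := 1 + 2^-1 `^ (t - 1).
have K0 : 0 <= K by rewrite addr_ge0// powR_ge0.
pose a j : R := K * (2 ^+ j)^-1 `^ (t - 1).
pose b j : R := K' * (4 ^+ j)^-1.
pose A j := `]0%R, (2 ^+ j)^-1]%classic : set R.
pose B j := `]0%R, (2 ^+ j.+1)%R]%classic : set R.
have a0 j : 0 <= a j by rewrite mulr_ge0 ?powR_ge0.
have b0 j : 0 <= b j by rewrite mulr_ge0// invr_ge0 exprn_ge0.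
pose h j x : R := a j * \1_(A j) x + b j * \1_(B j) x.
have h0 j x : 0 <= h j x by rewrite addr_ge0// mulr_ge0.
have mA j : measurable (A j) by exact: measurable_itv.
have mB j : measurable (B j) by exact: measurable_itv.
have m1A j : measurable_fun setT (\1_(A j) : R -> R) by exact: measurable_indic.
have m1B j : measurable_fun setT (\1_(B j) : R -> R) by exact: measurable_indic.
have mh j : measurable_fun setT (h j).
  by apply: measurable_funD; apply: measurable_funM.
pose D := `]0%R, +oo[%classic : set R.
have mD : measurable D by exact: measurable_itv.
apply: (@le_lt_trans _ _ (\int[mu]_(x in D) \sum_(j <oo) (h j x)%:E)%E).
  apply: ge0_le_integral => //.
  - by move=> x _; rewrite lee_fin gamma_integrand_ge0.
  - apply/measurable_EFinP; apply: measurable_funTS.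
    exact: measurable_gamma_integrand.
  - apply: ge0_emeasurable_sum => j; first by move=> y _ _; rewrite lee_fin.
    by move=> _; apply/measurable_EFinP; apply: measurable_funTS; exact: mh.
  - move=> x; rewrite /D /= in_itv/= andbT => x0.
    have [x1|/ltW x1] := lerP 1 x.
      have [j /andP[j1 j2]] := dyadic_lt x1.
      apply: (@le_trans _ _ (h j x)%:E).
        rewrite lee_fin (le_trans (HK' _ _ j1))// /h.
        rewrite [\1_(B j) x]indicE mem_set/= ?mulr1 ?lerDr ?mulr_ge0//.
        by rewrite /B/= in_itv/= x0 ltW.
      by apply: (le_nneseries (f := fun j => (h j x)%:E)) => i; rewrite lee_fin.
    have [|j j12] := @dyadic_lt R x^-1; first by rewrite invf_ge1.
    apply: (@le_trans _ _ (h j x)%:E).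
      rewrite lee_fin (le_trans (gamma_integrand_le_near0 _ j12 x0))// /h.
      rewrite [\1_(A j) x]indicE mem_set/= ?mulr1 ?lerDl ?mulr_ge0//.
      case/andP: j12 => j1 _.
      by rewrite /A/= in_itv/= x0 -[leLHS]invrK lef_pV2 ?posrE ?exprn_gt0 ?invr_gt0.
    by apply: (le_nneseries (f := fun j => (h j x)%:E)) => i; rewrite lee_fin.
rewrite integral_nneseries//; last 2 first.
  - by move=> j; apply/measurable_EFinP; apply: measurable_funTS; exact: mh.
  - by move=> j y _; rewrite lee_fin.
(* the ratio near 0 is 2 ^ (- t), the one near infinity is 1/2 *)
pose q : R := Num.max (2 `^ (- t)) 2^-1.
have q12 : 2^-1 <= q by rewrite le_max lexx orbT.
have q0 : 0 <= q by apply: le_trans q12.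
have q1 : q < 1.
  rewrite gt_max invf_lt1// ltr1n andbT powRN invf_lt1 ?powR_gt0//.
  have {1}-> : 1 = 1 `^ t :> R by rewrite powR1.
  by apply: gt0_ltr_powR; rewrite ?nnegrE// ltr1n.
apply: (@le_lt_trans _ _ (((K + 2 * K') / (1 - q))%:E)); last exact: ltry.
apply: nneseries_geometric_le => //.
- by rewrite addr_ge0// mulr_ge0.
- by rewrite q0.
- by move=> j; apply: integral_ge0 => y _; rewrite lee_fin.
move=> j.
have muD r : 0 < r -> (mu (`]0%R, r]%classic `&` D) = r%:E)%E.
  move=> r0; rewrite setIidl; last first.
    by move=> x /=; rewrite /D/= !in_itv/= andbT => /andP[].
  by rewrite [LHS]lebesgue_measure_itv/= lte_fin r0 oppr0 adde0.
have intD r : 0 < r -> (\int[mu]_(x in D) (\1_(`]0%R, r]%classic) x)%:E = r%:E)%E.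
  by move=> r0; rewrite integral_indic//; exact: muD.
rewrite /h integral_EFin_lin//; last 2 first.
- exact: m1A.
- exact: m1B.
rewrite /A /B !intD ?invr_gt0 ?exprn_gt0//.
rewrite -!EFinM -EFinD lee_fin mulrDl; apply: lerD.
  rewrite /a -mulrA ler_wpM2l// mulrC mulr_powRB1 ?invr_ge0 ?exprn_ge0//.
  have -> : (2 ^+ j)^-1 `^ t = (2 `^ (- t)) ^+ j :> R.
    rewrite -powR_inv1 ?exprn_ge0// -powRrM mulN1r -powR_mulrn// powRAC.
    by rewrite powR_mulrn// powR_ge0.
  by rewrite lerXn2r ?nnegrE ?powR_ge0// le_max lexx.
have -> : b j * 2 ^+ j.+1 = 2 * K' * (2^-1) ^+ j.
  rewrite /b exprVn exprS.
  have -> : 4 ^+ j = (2 ^+ j) ^+ 2 :> R.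
    by rewrite -exprM mulnC exprM; congr (_ ^+ _); rewrite -natrX.
  by field; rewrite expf_neq0// pnatr_eq0.
by rewrite ler_wpM2l ?mulr_ge0// lerXn2r ?nnegrE ?invr_ge0.
Qed.

Lemma cns_gt0 (n : nat) (s : R) : 0 < s < 1 -> 0 < cns n s.
Proof.
move=> /andP[s0 s1]; rewrite /cns !mulr_gt0 ?powR_gt0 ?pi_gt0//.
  by apply: Gamma_gt0; rewrite divr_gt0// ltr_wpDl// mulr_gt0.
by rewrite invr_gt0; apply: Gamma_gt0; rewrite subr_gt0.
Qed.

End gamma.

(** * Energies *)
Section energy.
Context {R : realType} (n : nat).
Local Notation V := 'rV[R]_n.
Local Notation mu := (lebesgue_rV R n).
Implicit Types (k : V -> R) (u : V -> R) (A B : set V).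

Definition energy_density k u (z : V * V) : R :=
  (u z.1 - u z.2) ^+ 2 * k (z.1 - z.2).

Lemma measurable_energy_density k u : measurable_fun setT k ->
  measurable_fun setT u -> measurable_fun setT (energy_density k u).
Proof.
move=> mk mu0; apply: measurable_funM; last first.
  exact: (measurableT_comp mk (@measurable_rVB _ _)).
apply: measurable_funX; apply: measurable_funB.
  exact: (measurableT_comp mu0 measurable_fst).
exact: (measurableT_comp mu0 measurable_snd).
Qed.

Lemma energy_density_ge0 k u z : (forall x, 0 <= k x) -> 0 <= energy_density k u z.
Proof. by move=> k0; rewrite mulr_ge0 ?sqr_ge0. Qed.

Lemma kenergy_ge0 k u : (forall x, 0 <= k x) -> (0 <= kenergy k u)%E.
Proof. by move=> k0; apply: integral_ge0 => z _; rewrite lee_fin energy_density_ge0. Qed.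

(** Kernels are compared away from [0] only, as the density vanishes on the
    diagonal. *)
Lemma kenergy_le_lin (a b : R) k k1 k2 u : 0 <= a -> 0 <= b ->
  (forall x, 0 <= k x) -> (forall x, 0 <= k1 x) -> (forall x, 0 <= k2 x) ->
  measurable_fun setT k -> measurable_fun setT k1 -> measurable_fun setT k2 ->
  measurable_fun setT u ->
  (forall x, x != 0 -> k x <= a * k1 x + b * k2 x) ->
  (kenergy k u <= a%:E * kenergy k1 u + b%:E * kenergy k2 u)%E.
Proof.
move=> a0 b0 k0 k10 k20 mk mk1 mk2 mu0 kk.
apply: (@le_integral_lin _ _ R (mu \x mu)%E setT a b (energy_density k u)
  (energy_density k1 u) (energy_density k2 u)) => //;
  try exact: measurable_energy_density; try (move=> z; exact: energy_density_ge0).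
move=> [x y] _; rewrite /energy_density /=.
have [->|xy] := eqVneq x y; first by rewrite !subrr expr0n/= !mul0r !mulr0 addr0.
rewrite [a * _]mulrCA [b * _]mulrCA -mulrDr ler_wpM2l ?sqr_ge0//.
by apply: kk; rewrite subr_eq0.
Qed.

Lemma kenergyE k u : (forall x, 0 <= k x) -> measurable_fun setT k ->
  measurable_fun setT u ->
  (kenergy k u = \int[mu]_x \int[mu]_y ((u x - u y) ^+ 2 * k (x - y))%:E)%E.
Proof.
move=> k0 mk mu0; rewrite /kenergy.
apply: (@fubini_tonelli1 _ _ V V R mu mu (EFin \o energy_density k u)).
  by apply/measurable_EFinP; exact: measurable_energy_density.
by move=> z; rewrite /= lee_fin energy_density_ge0.
Qed.

Lemma far_kernelB (sigma delta : R) (x y : V) :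
  far_kernel sigma delta (x - y) = far_kernel sigma delta (y - x).
Proof.
rewrite /far_kernel /kernel_frac enormB; congr (_ * _).
by rewrite !indicE; congr (nat_of_bool _)%:R; apply/idP/idP; rewrite !inE/= enormB.
Qed.

(** Far from the diagonal the energy is controlled by the square integral: each
    of [u x] and [u y] sees the tail of the kernel, integrated in the other
    variable. *)
Lemma kenergy_far (sigma delta : R) : 0 < sigma -> 0 < delta ->
  exists2 C : R, 0 <= C & forall u, measurable_fun setT u ->
  (kenergy (far_kernel sigma delta) u <=
   C%:E * \int[mu]_x (u x ^+ 2)%:E)%E.
Proof.
move=> s0 d0; have [C C0 HC] := @tail_kernel_frac R n sigma delta s0 d0.
exists (4 * C) => [|u mu0]; first by rewrite mulr_ge0.
pose K := @far_kernel R n sigma delta.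
have K0 x : 0 <= K x by exact: far_kernel_ge0.
have mK : measurable_fun setT (fun z : V * V => K (z.1 - z.2)).
  exact: (measurableT_comp (@measurable_far_kernel _ _ _ _) (@measurable_rVB _ _)).
have mu2 : measurable_fun setT (fun x => u x ^+ 2) by exact: measurable_funX.
pose g1 (z : V * V) := u z.1 ^+ 2 * K (z.1 - z.2).
pose g2 (z : V * V) := u z.2 ^+ 2 * K (z.1 - z.2).
have mg1 : measurable_fun setT g1.
  apply: measurable_funM => //.
  exact: (measurableT_comp mu2 measurable_fst).
have mg2 : measurable_fun setT g2.
  apply: measurable_funM => //.
  exact: (measurableT_comp mu2 measurable_snd).
have g10 z : 0 <= g1 z by rewrite mulr_ge0 ?sqr_ge0.
have g20 z : 0 <= g2 z by rewrite mulr_ge0 ?sqr_ge0.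
have tail x : (\int[mu]_y (u x ^+ 2 * K (x - y))%:E <= C%:E * (u x ^+ 2)%:E)%E.
  rewrite (@integral_EFinZ _ _ R mu setT (u x ^+ 2) (fun y => K (x - y)))//.
  - by rewrite muleC lee_wpmul2r ?lee_fin ?sqr_ge0//; exact: HC.
  - exact: sqr_ge0.
  exact: (measurableT_comp (@measurable_far_kernel _ _ _ _) (measurable_rVBl x)).
have I2 (F : V -> \bar R) : measurable_fun setT F -> (forall x, 0 <= F x)%E ->
   (forall x, F x <= C%:E * (u x ^+ 2)%:E)%E ->
   (\int[mu]_x F x <= C%:E * \int[mu]_x (u x ^+ 2)%:E)%E.
  move=> mF F0 FC.
  rewrite -(@integral_EFinZ _ _ R mu setT C (fun x => u x ^+ 2))//; last first.
    by move=> x; exact: sqr_ge0.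
  apply: ge0_le_integral => //.
  by apply/measurable_EFinP; apply: measurable_funM.
apply: (@le_trans _ _ (2%:E * \int[mu \x mu]_z (g1 z)%:E
                     + 2%:E * \int[mu \x mu]_z (g2 z)%:E)%E).
  apply: (@le_integral_lin _ _ R (mu \x mu)%E setT 2 2
    (energy_density K u) g1 g2) => //.
  - apply: measurable_energy_density => //; exact: measurable_far_kernel.
  - by move=> z; exact: energy_density_ge0.
  - move=> [x y] _; rewrite /energy_density /g1 /g2 /=.
    move: (K0 (x - y)); move: (K (x - y)) (u x) (u y) => t a b t0.
    rewrite !mulrA -mulrDl ler_wpM2r//.
    by have := sqr_ge0 (a + b); nra.
have -> : ((4 * C)%:E * \int[mu]_x (u x ^+ 2)%:E =
  2%:E * (C%:E * \int[mu]_x (u x ^+ 2)%:E)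
  + 2%:E * (C%:E * \int[mu]_x (u x ^+ 2)%:E))%E.
  by rewrite !muleA -ge0_muleDl ?lee_fin ?mulr_ge0// -!EFinM -EFinD; congr (_%:E * _)%E; ring.
have mE1 : measurable_fun setT (EFin \o g1) by exact/measurable_EFinP.
have mE2 : measurable_fun setT (EFin \o g2) by exact/measurable_EFinP.
have E10 z : (0 <= (EFin \o g1) z)%E by rewrite lee_fin.
have E20 z : (0 <= (EFin \o g2) z)%E by rewrite lee_fin.
apply: leeD; rewrite lee_pmul2l ?lte_fin//.
  rewrite [leLHS](@fubini_tonelli1 _ _ V V R mu mu (EFin \o g1))//.
  apply: I2 => //.
    exact: (@measurable_fun_fubini_tonelli_F _ _ V V R mu (EFin \o g1)).
  by move=> x; apply: integral_ge0 => y _; rewrite lee_fin.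
rewrite [leLHS](@fubini_tonelli2 _ _ V V R mu mu (EFin \o g2))//.
apply: (I2 (fubini_G mu (EFin \o g2))).
- exact: (@measurable_fun_fubini_tonelli_G _ _ V V R mu (EFin \o g2)).
- by move=> x; apply: integral_ge0 => y _; rewrite lee_fin.
move=> y; rewrite (_ : fubini_G _ _ y =
  \int[mu]_x (u y ^+ 2 * K (y - x))%:E)%E; first exact: tail.
by apply: eq_integral => x _; rewrite /g2 /= /K far_kernelB.
Qed.

Lemma integral_setX A B (f : V * V -> R) : measurable A -> measurable B ->
  measurable_fun setT f -> (forall z, 0 <= f z) ->
  (\int[mu \x mu]_(z in A `*` B) (f z)%:E =
   \int[mu]_(x in A) \int[mu]_(y in B) (f (x, y))%:E)%E.
Proof.
move=> mA mB mf f0.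
rewrite [LHS]integral_mkcond.
rewrite [LHS](@fubini_tonelli1 _ _ V V R mu mu ((EFin \o f) \_ (A `*` B))).
- rewrite [RHS]integral_mkcond; apply: eq_integral => x _; rewrite /fubini_F.
  rewrite [in RHS]patchE; case: ifPn => xA.
    rewrite [RHS]integral_mkcond; apply: eq_integral => y _.
    by rewrite !patchE in_setX xA.
  by rewrite integral0_eq// => y _; rewrite patchE in_setX (negbTE xA).
- apply/(measurable_restrictT _ _).1; first exact: measurableX.
  by apply/measurable_funTS/measurable_EFinP.
- by move=> z; rewrite patchE; case: ifP => // _; rewrite lee_fin.
Qed.

End energy.

(** * Grids of cubes *)
Section grid.
Context {R : realType} (n : nat).
Local Notation V := 'rV[R]_n.
Local Notation mu := (lebesgue_rV R n).

Lemma bounded_set_ccube (Omega : set V) : bounded_set Omega ->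
  exists2 K : R, 0 < K & Omega `<=` ccube 0 K.
Proof.
move=> [M [_ HM]]; exists (`|M| + 2); first by rewrite ltr_wpDl.
move=> x Ox; have xM : `|x| <= `|M| + 1.
  by apply: HM => //; rewrite (le_lt_trans (ler_norm M))// ltrDl.
have : ball x (`|M| + 2) 0.
  rewrite -ball_normE /= subr0 (le_lt_trans xM)// ltrD2l.
  by rewrite ltr1n.
case=> _ H i; have := H ord0 i; rewrite /ball /= !mxE.
by rewrite subr0 ltr_norml; move: (`|M|) => N; lra.
Qed.

Definition grid_vertex (a : V) (h : R) N (f : {ffun 'I_n -> 'I_N.+1}) : V :=
  \row_i (a ord0 i + (f i)%:R * h).

(** [N.+1] rather than [N], so that indices can be built with [inord]. *)
Lemma grid_cover (a : V) (h : R) N : 0 < h ->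
  cube a (N.+1%:R * h) =
  \big[setU/set0]_(f <- index_enum {ffun 'I_n -> 'I_N.+1}) cube (grid_vertex a h f) h.
Proof.
move=> h0; rewrite -bigcup_seq; apply/seteqP; split => [x Hx|x [f _] Hx i].
  pose f := [ffun i : 'I_n => inord (Num.truncn ((x ord0 i - a ord0 i) / h)) : 'I_N.+1].
  exists f; first by rewrite /= mem_index_enum.
  move=> i; rewrite mxE ffunE.
  have /andP[xi1 xi2] := Hx i.
  have t0 : 0 <= (x ord0 i - a ord0 i) / h by rewrite divr_ge0 ?(ltW h0)// subr_ge0.
  rewrite inordK; last first.
    by rewrite truncn_lt_nat// ltr_pdivrMr// ltrBlDl.
  have /andP[] := truncn_itv t0; rewrite -natr1.
  move: (Num.truncn _)%:R => t; rewrite ler_pdivlMr// ltr_pdivrMr// mulrDl mul1r.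
  by rewrite lerBrDl ltrBlDl addrA => -> ->.
have := Hx i; rewrite mxE => /andP[x1 x2]; apply/andP; split.
  by apply: le_trans x1; rewrite lerDl mulr_ge0 ?(ltW h0).
apply: (lt_le_trans x2); rewrite -addrA lerD2l -[X in _ + X]mul1r -mulrDl.
by rewrite ler_wpM2r ?(ltW h0)// natr1 ler_nat ltn_ord.
Qed.

Lemma grid_trivIset (a : V) (h : R) N : 0 < h ->
  trivIset setT (fun f : {ffun 'I_n -> 'I_N.+1} => cube (grid_vertex a h f) h).
Proof.
move=> h0; have lt_disj (f g : {ffun 'I_n -> 'I_N.+1}) (x : V) i : (f i < g i)%N ->
    cube (grid_vertex a h f) h x -> cube (grid_vertex a h g) h x -> False.
  move=> fg /(_ i) + /(_ i); rewrite !mxE => /andP[_ x2] /andP[x1 _].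
  have := le_lt_trans x1 x2; rewrite -addrA ltrD2l -[X in _ + X]mul1r -mulrDl.
  by rewrite ltr_pM2r// natr1 ltr_nat ltnS leqNgt fg.
move=> f g _ _ [x [xf xg]]; apply/ffunP => i; apply/val_inj.
by case: (ltngtP (f i) (g i)) => // fg; exfalso; apply: lt_disj fg _ _; eassumption.
Qed.

Lemma integral_grid (a : V) (h : R) N (g : V -> R) : 0 < h ->
  measurable_fun setT g -> (forall x, 0 <= g x) ->
  (\int[mu]_(x in cube a (N.+1%:R * h)) (g x)%:E =
   \sum_(f : {ffun 'I_n -> 'I_N.+1})
     \int[mu]_(x in cube (grid_vertex a h f) h) (g x)%:E)%E.
Proof.
move=> h0 mg g0; rewrite grid_cover// ge0_integral_bigsetU//.
- by move=> f; exact: measurable_cube.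
- exact: index_enum_uniq.
- by apply: sub_trivIset (@grid_trivIset a h N h0).
- by apply/measurable_EFinP; exact: measurable_funTS.
- by move=> x _; rewrite lee_fin.
Qed.

End grid.

Section vanishing.
Context {R : realType} (n : nat).
Local Notation V := 'rV[R]_n.
Local Notation mu := (lebesgue_rV R n).
Implicit Types (Omega A : set V) (g : V -> R).

Lemma integral_zero_outside Omega A g : measurable A -> measurable_fun setT g ->
  (forall x, 0 <= g x) -> zero_outside Omega g -> A `&` Omega = set0 ->
  (\int[mu]_(x in A) (g x)%:E = 0)%E.
Proof.
move=> mA mg g0 zg AO.
rewrite (ge0_ae_eq_integral (g := cst 0%E))//; first exact: integral0.
- by apply/measurable_EFinP; exact: measurable_funTS.
- by move=> x _; rewrite lee_fin.
apply: filterS zg => x zx Ax /=; rewrite zx// => Ox.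
by have : (A `&` Omega) x by []; rewrite AO.
Qed.

Lemma integral_zero_outsideT Omega A g : measurable A -> measurable_fun setT g ->
  (forall x, 0 <= g x) -> zero_outside Omega g -> Omega `<=` A ->
  (\int[mu]_x (g x)%:E = \int[mu]_(x in A) (g x)%:E)%E.
Proof.
move=> mA mg g0 zg OA; rewrite -(setUv A) ge0_integral_setU//.
- rewrite [X in (_ + X)%E](@integral_zero_outside Omega) ?adde0//.
    exact: measurableC.
  by apply/seteqP; split => // x [nAx Ox]; exact: nAx (OA _ Ox).
- exact: measurableC.
- by rewrite setUv; apply/measurable_EFinP.
- by move=> x _; rewrite lee_fin.
- by apply/disj_setPCl.
Qed.

End vanishing.

(** * Poincare inequality *)
Section poincare.
Context {R : realType} (n : nat).
Local Notation V := 'rV[R]_n.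
Local Notation mu := (lebesgue_rV R n).
Implicit Types (A B : set V) (u : V -> R) (k : V -> R).

Definition osc u (z : V * V) : R := (u z.1 - u z.2) ^+ 2.

Lemma measurable_osc u : measurable_fun setT u -> measurable_fun setT (osc u).
Proof.
move=> mu0; apply: measurable_funX; apply: measurable_funB.
  exact: (measurableT_comp mu0 measurable_fst).
exact: (measurableT_comp mu0 measurable_snd).
Qed.

Lemma osc_ge0 u z : 0 <= osc u z. Proof. exact: sqr_ge0. Qed.

(** Averaging [u x ^+ 2 <= 2 * (u x - u y) ^+ 2 + 2 * u y ^+ 2] over [y] in [B]. *)
Lemma integral_sqr_le_osc A B u (a b : R) : measurable A -> measurable B ->
  0 <= a -> 0 <= b -> mu A = a%:E -> mu B = b%:E -> measurable_fun setT u ->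
  (b%:E * \int[mu]_(x in A) (u x ^+ 2)%:E <=
   2%:E * \int[mu \x mu]_(z in A `*` B) (osc u z)%:E
   + 2%:E * (a%:E * \int[mu]_(x in B) (u x ^+ 2)%:E))%E.
Proof.
move=> mA mB a0 b0 muA muB mu0.
have mu2 : measurable_fun setT (fun x => u x ^+ 2) by exact: measurable_funX.
have m1 : measurable_fun setT (fun z : V * V => u z.1 ^+ 2).
  exact: (measurableT_comp mu2 measurable_fst).
have m2 : measurable_fun setT (fun z : V * V => u z.2 ^+ 2).
  exact: (measurableT_comp mu2 measurable_snd).
have -> : (b%:E * \int[mu]_(x in A) (u x ^+ 2)%:E =
    \int[mu \x mu]_(z in A `*` B) (u z.1 ^+ 2)%:E)%E.
  rewrite integral_setX//; last by move=> z; exact: sqr_ge0.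
  rewrite -(@integral_EFinZ _ _ R mu A b (fun x => u x ^+ 2))//; last first.
    by move=> x; exact: sqr_ge0.
  apply: eq_integral => x _ /=.
  by rewrite [RHS](integral_cst mu mB) [X in (_ * X)%E]muB muleC.
have -> : (a%:E * \int[mu]_(x in B) (u x ^+ 2)%:E =
    \int[mu \x mu]_(z in A `*` B) (u z.2 ^+ 2)%:E)%E.
  rewrite integral_setX//; last by move=> z; exact: sqr_ge0.
  by rewrite /= [RHS](integral_cst mu mA) muleC -muA.
apply: (@le_integral_lin _ _ R (mu \x mu)%E (A `*` B) 2 2
  (fun z => u z.1 ^+ 2) (osc u) (fun z => u z.2 ^+ 2)) => //;
  try (by move=> z; exact: sqr_ge0); try exact: measurable_osc.
- exact: measurableX.
move=> [x y] _ /=; rewrite /osc /=; move: (u x) (u y) => c d.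
by have := sqr_ge0 (c - 2 * d); nra.
Qed.

Lemma integral_osc_le_energy (A : set (V * V)) u k (kappa : R) : measurable A ->
  0 < kappa -> (forall z, 0 <= k z) -> measurable_fun setT k ->
  measurable_fun setT u ->
  (forall z, A z -> z.1 != z.2 -> kappa <= k (z.1 - z.2)) ->
  (\int[mu \x mu]_(z in A) (osc u z)%:E <=
   kappa^-1%:E * \int[mu \x mu]_(z in A) (energy_density k u z)%:E)%E.
Proof.
move=> mA kappa0 k0 mk mu0 kk.
apply: (@le_integralZ _ _ R (mu \x mu)%E A kappa^-1 (osc u) (energy_density k u)) => //.
- by rewrite invr_ge0 ltW.
- exact: measurable_osc.
- exact: measurable_energy_density.
- exact: osc_ge0.
- by move=> z; exact: energy_density_ge0.
move=> [x y] Az; have [<-|xy] := eqVneq x y.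
  by rewrite /osc /energy_density /= subrr expr0n/= mul0r mulr0.
rewrite mulrC ler_pdivlMr//.
by rewrite ler_wpM2l ?osc_ge0//; exact: kk.
Qed.


End poincare.

Section poincare.
Context {R : realType} (n : nat).
Local Notation V := 'rV[R]_n.
Local Notation mu := (lebesgue_rV R n).
Variables (Omega : set V) (K : R) (k : V -> R) (kappa delta : R).
Hypotheses (n0 : (0 < n)%N) (K0 : 0 < K) (OK : Omega `<=` ccube 0 K).
Hypotheses (k0 : forall z, 0 <= k z) (mk : measurable_fun setT k).
Hypotheses (kappa0 : 0 < kappa) (delta0 : 0 < delta).
Hypothesis kk : forall z, z != 0 -> enorm z <= delta -> kappa <= k z.

Let i0 : 'I_n := Ordinal n0.
Let h : R := delta / (2 * n%:R).
Let h0 : 0 < h. Proof. by rewrite divr_gt0// mulr_gt0// ltr0n. Qed.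

(** Induction on the number [m] of steps of length [h] which lead from the cube out
    of [ccube 0 K] in the direction [i0]: the square integral over a cube is bounded
    by that over the next one, up to the oscillation between the two, and these are
    close enough for the oscillation to be seen by the kernel. *)
Let poincare_cube m : exists2 C : R, 0 <= C & forall (a : V) u,
  K <= a ord0 i0 + m%:R * h -> measurable_fun setT u -> zero_outside Omega u ->
  (\int[mu]_(x in cube a h) (u x ^+ 2)%:E <= C%:E * kenergy k u)%E.
Proof.
elim: m => [|m [C C0 IH]].
  exists 0 => // a u; rewrite mul0r addr0 mul0e => Ka mu0 zu.
  rewrite (@integral_zero_outside _ _ Omega)//.
  - exact: measurable_cube.
  - exact: measurable_funX.
  - by move=> x; exact: sqr_ge0.
  - by apply: filterS zu => x zx Ox; rewrite zx// expr0n.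
  apply/seteqP; split => // x [/(_ i0) xa /OK /(_ i0)].
  by rewrite !mxE sub0r; lra.
have hn0 : 0 < h ^+ n by exact: exprn_gt0.
exists ((h ^+ n)^-1 * (2 * kappa^-1 + 2 * h ^+ n * C)) => [|a u Ka mu0 zu].
  rewrite mulr_ge0 ?invr_ge0 ?(ltW hn0)// addr_ge0// !mulr_ge0 ?invr_ge0//; exact: ltW.
pose b : V := \row_i (a ord0 i + (if i == i0 then h else 0)).
have mA x : measurable (cube (x : V) h) by exact: measurable_cube.
have IHb : (\int[mu]_(x in cube b h) (u x ^+ 2)%:E <= C%:E * kenergy k u)%E.
  by apply: IH => //; rewrite mxE eqxx -addrA -[X in X + _ * _]mul1r -mulrDl nat1r.
have E0 : (0 <= kenergy k u)%E by exact: kenergy_ge0.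
have := @integral_sqr_le_osc _ _ _ _ u _ _ (mA a) (mA b) (ltW hn0) (ltW hn0)
  (lebesgue_cube a (ltW h0)) (lebesgue_cube b (ltW h0)) mu0.
have HJ : (\int[mu \x mu]_(z in cube a h `*` cube b h) (osc u z)%:E <=
    kappa^-1%:E * kenergy k u)%E.
  apply: (le_trans (@integral_osc_le_energy _ _ (cube a h `*` cube b h) u k kappa
    _ kappa0 k0 mk mu0 _)).
  - exact: measurableX.
  - move=> [x y] [/= xa yb] xy; apply: kk; first by rewrite subr_eq0.
    have := @enorm_le_coord R n (x - y) (2 * h).
    have -> : n%:R * (2 * h) = delta.
      by rewrite /h; field; rewrite pnatr_eq0 -lt0n n0.
    apply; first by rewrite mulr_ge0// ltW.
    move=> i; rewrite !mxE ler_norml.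
    by have := xa i; have := yb i; rewrite !mxE; case: (i == i0); have := h0; lra.
  rewrite lee_wpmul2l ?lee_fin ?invr_ge0 ?(ltW kappa0)//.
  apply: (@subset_integral_EFin _ _ R (mu \x mu)%E (cube a h `*` cube b h) setT
    (energy_density k u)) => //; first exact: measurableX.
    exact: measurable_energy_density.
  by move=> z; exact: energy_density_ge0.
move=> H; rewrite EFinM -muleA lee_pdivlMl//.
have k1 : 0 <= 2 * kappa^-1 by rewrite mulr_ge0// invr_ge0 ltW.
have k2 : 0 <= 2 * h ^+ n * C by rewrite !mulr_ge0// ltW.
apply: (le_trans H); rewrite [in leRHS]EFinD [leRHS]ge0_muleDl ?lee_fin//.
apply: leeD; first by rewrite EFinM -muleA lee_pmul2l// lte_fin.
by rewrite !EFinM -!muleA !lee_pmul2l// lte_fin.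
Qed.

(** A kernel bounded below near the origin controls the square integral, even if
    its support is much smaller than [Omega]. *)
Lemma poincare : exists2 C : R, 0 <= C & forall u,
  measurable_fun setT u -> zero_outside Omega u ->
  (\int[mu]_x (u x ^+ 2)%:E <= C%:E * kenergy k u)%E.
Proof.
pose N := Num.truncn (2 * K / h).
have KN : 2 * K < N.+1%:R * h by rewrite -ltr_pdivrMr//; exact: truncnS_gt.
have [C C0 HC] := poincare_cube N.+1.
exists (\sum_(f : {ffun 'I_n -> 'I_N.+1}) C) => [|u mu0 zu].
  by apply: sumr_ge0.
pose a : V := 0 - const_mx K.
rewrite (@integral_zero_outsideT _ _ Omega (cube a (N.+1%:R * h))).
- rewrite integral_grid//; last 2 first.
  + exact: measurable_funX.
  + by move=> x; exact: sqr_ge0.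
  rewrite -sumEFin ge0_sume_distrl//.
  apply: lee_sum => f _; apply: HC => //.
  rewrite !mxE sub0r; have : 0 <= (f i0)%:R * h by rewrite mulr_ge0 ?(ltW h0).
  move: KN; move: (N.+1%:R * h) ((f i0)%:R * h) => p q; lra.
- exact: measurable_cube.
- exact: measurable_funX.
- by move=> x; exact: sqr_ge0.
- by apply: filterS zu => x zx Ox; rewrite zx// expr0n.
move=> x /OK Hx i; have := Hx i => /andP[-> /lt_trans]; apply.
by rewrite ltrD2l.
Qed.

End poincare.

(** * The logarithmic kernel *)
Section kernels.
Context {R : realType} (n : nat) (s : R).
Hypothesis s01 : 0 < s < 1.
Local Notation V := 'rV[R]_n.

Let s0 : 0 < s. Proof. by case/andP: s01. Qed.
Let c0 : 0 < cns n s. Proof. exact: cns_gt0. Qed.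

Lemma enorm_gt0 (z : V) : z != 0 -> 0 < enorm z.
Proof.
by move=> z0; rewrite lt_neqAle enorm_ge0 andbT eq_sym; apply: contra z0 => /eqP/enorm_eq0 ->.
Qed.

Lemma kernel_frac_ge0 sigma (z : V) : 0 <= kernel_frac sigma z.
Proof. by rewrite invr_ge0 powR_ge0. Qed.

Lemma kernel_log_ge0 (z : V) : 0 <= kernel_log s z.
Proof.
apply: mulr_ge0; last by rewrite le_max lexx.
by apply: mulr_ge0; [exact: ltW|exact: powR_ge0].
Qed.

Lemma measurable_kernel_log : measurable_fun setT (@kernel_log R n s).
Proof.
apply: measurable_funM; first apply: measurable_funM => //.
  exact: (measurableT_comp (measurable_powR _) (@measurable_enorm _ _)).
apply: measurable_maxr => //; apply: measurable_funN.
exact: (measurableT_comp (@measurable_ln R) (@measurable_enorm _ _)).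
Qed.

Lemma kernel_log_ge (z : V) : z != 0 -> enorm z <= 2^-1 ->
  cns n s * ln 2 <= kernel_log s z.
Proof.
move=> z0 z2; have r0 := enorm_gt0 z0.
have ln20 : 0 < ln 2 :> R by rewrite ln_gt0// ltr1n.
rewrite /kernel_log; move: (cns n s) c0 => c cp.
rewrite -mulrA ler_wpM2l ?(ltW cp)//.
have lnz : ln 2 <= - ln (enorm z).
  by rewrite -[2]invrK lnV ?posrE ?invr_gt0// lerN2 ler_ln ?posrE// invr_gt0.
rewrite (@le_trans _ _ (- ln (enorm z)))// (@le_trans _ _ (Num.max 0 (- ln (enorm z))))//.
  by rewrite le_max lexx orbT.
rewrite ler_peMl//; first by rewrite le_max lexx.
rewrite -[leLHS](powRr0 (enorm z)); apply: ger_powR.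
  by rewrite r0 (le_trans z2)// invf_le1// ler1n.
by rewrite -oppr_ge0; have := ler0n R n; have := s0; lra.
Qed.

(** At distance less than [expR (- L)] the logarithm is a gain of a factor [L]. *)
Lemma kernel_frac_le_log (L : R) (z : V) : 0 < L -> z != 0 ->
  kernel_frac s z <= (cns n s * L)^-1 * kernel_log s z + 1 * far_kernel s (expR (- L)) z.
Proof.
move=> L0 z0; have r0 := enorm_gt0 z0.
have cL : 0 < cns n s * L by exact: mulr_gt0.
rewrite mul1r /far_kernel indicE; have [zL|zL] := lerP (expR (- L)) (enorm z).
  rewrite mem_set//= mul1r lerDr mulr_ge0 ?kernel_log_ge0// invr_ge0; exact: ltW.
rewrite memNset/= ?mul0r ?addr0; last by rewrite leNgt zL.
rewrite mulrC ler_pdivlMr// /kernel_log /kernel_frac.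
move: (cns n s) c0 {cL} => c cp.
rewrite mulrC -!mulrA ler_wpM2l ?(ltW cp)//.
have -> : - n%:R - 2 * s = - (n%:R + 2 * s) by ring.
rewrite powRN mulrC ler_wpM2l ?invr_ge0 ?powR_ge0// le_max; apply/orP; right.
by rewrite lerNr -(expRK (- L)) ler_ln ?posrE ?expR_gt0// ltW.
Qed.

(** [ln t <= t] for [t = |z| ^ (- 2 eps)]. *)
Lemma kernel_log_le_frac (eps : R) (z : V) : 0 < eps -> z != 0 ->
  kernel_log s z <= (cns n s / (2 * eps)) * kernel_frac (s + eps) z.
Proof.
move=> e0 z0; have r0 := enorm_gt0 z0.
rewrite /kernel_log /kernel_frac; move: (cns n s) c0 => c cp.
rewrite -!mulrA ler_wpM2l ?(ltW cp)//.
have -> : n%:R + 2 * (s + eps) = (n%:R + 2 * s) + 2 * eps by ring.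
have -> : - n%:R - 2 * s = - (n%:R + 2 * s) by ring.
have e20 : 0 < 2 * eps by rewrite mulr_gt0.
move: (2 * eps) e20 => t t0.
rewrite powRD ?(gt_eqF r0) ?implybT// powRN [in leRHS]invfM [leRHS]mulrCA.
rewrite ler_wpM2l ?invr_ge0 ?powR_ge0// ge_max.
rewrite mulr_ge0 ?invr_ge0 ?powR_ge0 ?(ltW t0)//= ler_pdivlMl// -powRN.
apply: ltW; apply: le_lt_trans (ln_sublinear (powR_gt0 (- t) r0)).
by rewrite ln_powR mulrN mulNr.
Qed.

End kernels.

(** * Critical Sobolev inequality *)
Section power_interpolation.
Context {R : realType}.

(** One of the two terms suffices, according to whether [t <= lam]. Integrated, with
    [lam] chosen afterwards, this replaces Hoelder's inequality. *)
Lemma powR_interpolate (t lam p q : R) : 0 <= t -> 0 < lam -> 0 < p -> p <= q ->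
  t `^ p <= lam `^ (p - q) * t `^ q + lam `^ p.
Proof.
move=> t0 l0 p0 pq; have [tl|lt] := lerP t lam.
  rewrite ler_wpDl ?mulr_ge0 ?powR_ge0//.
  by apply: ge0_ler_powR; rewrite ?nnegrE// ltW.
have tp : 0 < t by exact: lt_trans lt.
rewrite ler_wpDr ?powR_ge0//.
have {1}-> : p = (p - q) + q by ring.
rewrite powRD ?(gt_eqF tp) ?implybT// ler_wpM2r ?powR_ge0//.
rewrite -(opprB q p) !powRN lef_pV2 ?posrE ?powR_gt0//.
by apply: ge0_ler_powR; rewrite ?nnegrE ?subr_ge0// ltW.
Qed.

Definition truncate (M t : R) : R := Num.max (- M) (Num.min t M).

Lemma normr_truncate (M t : R) : 0 <= M -> `|truncate M t| = Num.min `|t| M.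
Proof.
move=> M0; rewrite /truncate; have [tM|Mt] := leP t M.
  have [tNM|Mt] := leP (- M) t; first by rewrite min_l// ler_norml tNM tM.
  by rewrite normrN ger0_norm// min_r// ler0_norm; lra.
rewrite max_r; last by lra.
by rewrite ger0_norm// min_r// ger0_norm; lra.
Qed.

Lemma truncate_contract (M t t' : R) : 0 <= M ->
  `|truncate M t - truncate M t'| <= `|t - t'|.
Proof.
move=> M0; rewrite /truncate ler_norml.
have := ler_norm (t - t'); have := ler_norm (t' - t); rewrite (distrC t' t).
have [tM|Mt] := leP t M; have [tM'|Mt'] := leP t' M;
  have [?|?] := leP (- M) t; have [?|?] := leP (- M) t';
  have [?|?] := leP (- M) M; lra.
Qed.

End power_interpolation.

Section sobolev.
Context {R : realType} (n : nat) (s : R).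
Hypotheses (n0 : (0 < n)%N) (s01 : 0 < s < 1) (sn : 2 * s < n%:R).
Local Notation V := 'rV[R]_n.
Local Notation mu := (lebesgue_rV R n).

Definition sobolev_exponent : R := 2 * n%:R / (n%:R - 2 * s).
Local Notation q := sobolev_exponent.

Let s0 : 0 < s. Proof. by case/andP: s01. Qed.
Let n0R : 0 < n%:R :> R. Proof. by rewrite ltr0n. Qed.
Let nz : n%:R != 0 :> R. Proof. by rewrite gt_eqF. Qed.
Let ns0 : 0 < n%:R - 2 * s. Proof. by rewrite subr_gt0. Qed.
Let nsz : n%:R - 2 * s != 0. Proof. by rewrite gt_eqF. Qed.

Lemma sobolev_exponent_gt2 : 2 < q.
Proof. by rewrite ltr_pdivlMr// ltr_pM2l// ltrBlDr ltrDl mulr_gt0. Qed.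

Let q2 := sobolev_exponent_gt2.
Let q0 : 0 < q. Proof. by apply: lt_trans q2. Qed.

Definition slice_energy (u : V -> R) (x : V) : \bar R :=
  (\int[mu]_y ((u x - u y) ^+ 2 * kernel_frac s (x - y))%:E)%E.

(** On the cube the kernel is at least [(n r) ^ (- n - 2 s)]. *)
Lemma slice_osc_le (u : V -> R) (x : V) (r : R) : 0 < r -> measurable_fun setT u ->
  (\int[mu]_(y in ccube x r) ((u x - u y) ^+ 2)%:E <=
   ((n%:R * r) `^ (n%:R + 2 * s))%:E * slice_energy u x)%E.
Proof.
move=> r0 mu0; pose g y := (u x - u y) ^+ 2 * kernel_frac s (x - y).
have mB : measurable_fun setT (fun y => (u x - u y) ^+ 2).
  by apply: measurable_funX; exact: measurable_funB.
have mg : measurable_fun setT g.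
  apply: measurable_funM => //.
  exact: (measurableT_comp (measurable_kernel_frac s) (measurable_rVBl x)).
have g0 y : 0 <= g y by rewrite mulr_ge0 ?sqr_ge0 ?invr_ge0 ?powR_ge0.
apply: (@le_trans _ _ (((n%:R * r) `^ (n%:R + 2 * s))%:E *
   \int[mu]_(y in ccube x r) (g y)%:E)%E).
  apply: (@le_integralZ _ _ R mu (ccube x r) _ (fun y => (u x - u y) ^+ 2) g) => //.
  - exact: measurable_ccube.
  - exact: powR_ge0.
  - by move=> y; exact: sqr_ge0.
  move=> y Qy; have [<-|xy] := eqVneq x y.
    by rewrite subrr expr0n/= mulr_ge0 ?powR_ge0.
  rewrite /g mulrCA ler_peMr ?sqr_ge0//.
  have e0 : 0 < enorm (x - y) by rewrite enorm_gt0// subr_eq0.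
  rewrite ler_pdivlMr ?powR_gt0// mul1r.
  have nr := ccube_enorm_le (ltW r0) Qy.
  apply: ge0_ler_powR; rewrite ?nnegrE ?(ltW e0)//.
    by rewrite addr_ge0// mulr_ge0// ltW.
  exact: le_trans (enorm_ge0 _) nr.
rewrite lee_wpmul2l ?lee_fin ?powR_ge0//.
by apply: (@subset_integral_EFin _ _ R mu _ setT g) => //; exact: measurable_ccube.
Qed.

(** [|u|] cannot exceed half of [|u x|] on most of a cube about [x] whose volume is
    a large multiple of [I * |u x| ^ (- q)]; the cube of exactly that size turns the
    oscillation of [u] about [x] into a bound for [|u x| ^ q], the exponent [q]
    being the one for which all powers of [|u x|] and [r] match. *)
Lemma sobolev_pointwise : exists2 C : R, 0 < C & forall (u : V -> R) (I : R),
  measurable_fun setT u -> 0 < I -> (\int[mu]_x (`|u x| `^ q)%:E = I%:E)%E ->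
  forall x, ((`|u x| `^ q)%:E <= (C * I `^ (2 * s / n%:R))%:E * slice_energy u x)%E.
Proof.
pose C : R := 8 * (n%:R / 2) `^ (n%:R + 2 * s) * (2 `^ (q + 1)) `^ (2 * s / n%:R).
have C0 : 0 < C by rewrite !mulr_gt0 ?powR_gt0 ?divr_gt0.
exists C => // u I mu0 I0 HI x.
have D0 : (0 <= slice_energy u x)%E.
  by apply: integral_ge0 => y _; rewrite lee_fin mulr_ge0 ?sqr_ge0 ?invr_ge0 ?powR_ge0.
have CI : 0 < C * I `^ (2 * s / n%:R) by rewrite mulr_gt0 ?powR_gt0.
have [ux0|ux0] := eqVneq (u x) 0.
  by rewrite ux0 normr0 powR0 ?gt_eqF// mule_ge0 ?lee_fin ?(ltW CI).
pose a := `|u x|; have a0 : 0 < a by rewrite normr_gt0.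
(* the volume of the cube: the term of H2 with I is then an eighth of v * a ^+ 2 *)
pose v := 2 `^ (q + 1) * I * a `^ (- q).
have v0 : 0 < v by rewrite !mulr_gt0 ?powR_gt0.
pose r := v `^ n%:R^-1 / 2.
have r0 : 0 < r by rewrite divr_gt0 ?powR_gt0.
have r2 : 2 * r = v `^ n%:R^-1 by rewrite /r; field.
have muQ : mu (ccube x r) = v%:E.
  rewrite lebesgue_ccube ?(ltW r0)// r2 -powR_mulrn ?powR_ge0// -powRrM mulVf//.
  by rewrite powRr1 ?(ltW v0).
have mQ := measurable_ccube x r.
have mu2 : measurable_fun setT (fun y => u y ^+ 2) by exact: measurable_funX.
have mB : measurable_fun setT (fun y => (u x - u y) ^+ 2).
  by apply: measurable_funX; exact: measurable_funB.
have muq : measurable_fun setT (fun y => `|u y| `^ q).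
  apply: (measurableT_comp (measurable_powR _)).
  exact: (measurableT_comp (@normr_measurable R setT)).
(* interpolation between 2 and q, at height |u x| / 2 *)
have lam0 : 0 < a / 2 by rewrite divr_gt0.
have H2 : (\int[mu]_(y in ccube x r) (u y ^+ 2)%:E <=
    ((a / 2) `^ (2 - q) * I + (a / 2) ^+ 2 * v)%:E)%E.
  apply: (@le_trans _ _ (((a / 2) `^ (2 - q))%:E * \int[mu]_(y in ccube x r) (`|u y| `^ q)%:E
    + ((a / 2) ^+ 2)%:E * \int[mu]_(y in ccube x r) (cst 1 y)%:E)%E).
    apply: (@le_integral_lin _ _ R mu (ccube x r) _ _ (fun y => u y ^+ 2)
      (fun y => `|u y| `^ q) (cst 1)) => //.
    - exact: powR_ge0.
    - exact: sqr_ge0.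
    - by move=> y; exact: sqr_ge0.
    move=> y _ /=; rewrite mulr1 -real_normK ?num_real// -!powR_mulrn ?(ltW lam0)//.
    by apply: powR_interpolate => //; exact: ltW.
  rewrite EFinD; apply: leeD.
    rewrite EFinM lee_wpmul2l ?lee_fin ?powR_ge0// -HI.
    by apply: (@subset_integral_EFin _ _ R mu _ setT (fun y => `|u y| `^ q)).
  by rewrite /= (integral_cst_EFin 1 mQ muQ) mul1r -EFinM.
have H1 : ((v * a ^+ 2)%:E <=
    2%:E * \int[mu]_(y in ccube x r) ((u x - u y) ^+ 2)%:E +
    2%:E * \int[mu]_(y in ccube x r) (u y ^+ 2)%:E)%E.
  rewrite [v * _]mulrC -(integral_cst_EFin (a ^+ 2) mQ muQ).
  apply: (@le_integral_lin _ _ R mu (ccube x r) 2 2 (cst (a ^+ 2))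
      (fun y => (u x - u y) ^+ 2) (fun y => u y ^+ 2)) => //;
    try (by move=> y; exact: sqr_ge0).
  move=> y _ /=; rewrite real_normK ?num_real//; move: (u x) (u y) => b c.
  by have := sqr_ge0 (b - 2 * c); nra.
have H3 := slice_osc_le x r0 mu0.
case: (slice_energy u x) D0 H3 => [d|_ _|//]; last first.
  by rewrite gt0_muley ?leey// lte_fin.
rewrite lee_fin => d0 H3.
have two0 : (0 <= 2%:E :> \bar R)%E by rewrite lee_fin.
have := le_trans H1 (leeD (lee_wpmul2l two0 H3) (lee_wpmul2l two0 H2)).
rewrite -!EFinM -EFinD !lee_fin => H.
have an0 : a != 0 by rewrite gt_eqF.
have vn0 : v != 0 by rewrite gt_eqF.
have t0 : 2 != 0 :> R by rewrite pnatr_eq0.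
pose W := a `^ (q - 2); have W0 : 0 < W by exact: powR_gt0.
have WV : a `^ (2 - q) = W^-1 by rewrite -(opprB q) powRN.
have Ea : a `^ q = a ^+ 2 * W.
  rewrite -powR_mulrn ?(ltW a0)// -powRD ?an0 ?implybT//.
  by congr (a `^ _); ring.
have Elam : 2 * ((a / 2) `^ (2 - q) * I) = v * a ^+ 2 / 4.
  have E2 : 2^-1 `^ (2 - q) = 2 `^ (q - 2).
    by rewrite -powR_inv1// -powRrM mulN1r opprB.
  rewrite powRM ?(ltW a0)// WV E2 /v.
  have -> : 2 `^ (q + 1) = 2 `^ (q - 2) * 8.
    have -> : q + 1 = (q - 2) + 3%:R by ring.
    rewrite (@powRD _ 2 (q - 2)) ?t0 ?implybT// powR_mulrn//.
    by congr (_ * _); ring.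
  rewrite powRN Ea.
  by field; rewrite an0 gt_eqF.
have Er : (n%:R * r) `^ (n%:R + 2 * s) =
    (n%:R / 2) `^ (n%:R + 2 * s) * (v * v `^ (2 * s / n%:R)).
  have -> : n%:R * r = (n%:R / 2) * (2 * r) by field.
  rewrite powRM ?r2 ?powR_ge0 ?divr_ge0 ?(ltW n0R)// -powRrM; congr (_ * _).
  have -> : n%:R^-1 * (n%:R + 2 * s) = 1 + 2 * s / n%:R by field.
  by rewrite powRD ?vn0 ?implybT// powRr1 ?(ltW v0).
have Ev : v `^ (2 * s / n%:R) =
    (2 `^ (q + 1)) `^ (2 * s / n%:R) * I `^ (2 * s / n%:R) * W^-1.
  rewrite /v !powRM ?mulr_ge0 ?powR_ge0 ?(ltW I0)// -WV -(powRrM a).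
  congr (_ * a `^ _); rewrite /sobolev_exponent; field.
  by rewrite nz nsz.
have {}H : v * a ^+ 2 / 4 <= 2 * ((n%:R * r) `^ (n%:R + 2 * s) * d).
  move: H; rewrite mulrDr Elam; set A := v * a ^+ 2; set B := _ * d.
  have -> : 2 * ((a / 2) ^+ 2 * v) = A / 2 by rewrite /A; field.
  lra.
move: H; rewrite Er Ev Ea /C.
move: ((n%:R / 2) `^ _) ((2 `^ (q + 1)) `^ _) (I `^ _) => N A I' H.
have k0 : 0 <= 4 * W / v.
  by apply: divr_ge0; [apply: mulr_ge0 => //|]; exact: ltW.
have := ler_wpM2l k0 H; have Wn0 : W != 0 by rewrite gt_eqF.
have -> : 4 * W / v * (v * a ^+ 2 / 4) = a ^+ 2 * W by field.
have -> : 4 * W / v * (2 * (N * (v * (A * I' / W)) * d)) = 8 * N * A * I' * d.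
  by field; rewrite ?vn0 ?Wn0.
by [].
Qed.

Lemma measurable_slice_energy (u : V -> R) : measurable_fun setT u ->
  measurable_fun setT (slice_energy u).
Proof.
move=> mu0.
apply: (@measurable_fun_fubini_tonelli_F _ _ V V R mu
  (EFin \o energy_density (kernel_frac s) u)).
  apply/measurable_EFinP; apply: measurable_energy_density => //.
  exact: measurable_kernel_frac.
by move=> z; rewrite /= lee_fin energy_density_ge0// => y; exact: kernel_frac_ge0.
Qed.

(** The pointwise bound integrates to [I <= C * I ^ (2 s / n) * E_s u], where the
    power of [I], having exponent less than [1], is absorbed on the left: this is
    where [I] has to be finite. *)
Lemma sobolev_a_priori : exists2 C : R, 0 < C & forall (u : V -> R) (I e : R),
  measurable_fun setT u -> 0 <= e -> (\int[mu]_x (`|u x| `^ q)%:E = I%:E)%E ->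
  (kenergy (kernel_frac s) u <= e%:E)%E -> I <= (C * e) `^ (q / 2).
Proof.
have [C C0 HC] := sobolev_pointwise; exists C => // u I e mu0 e0 HI Ee.
have I0 : 0 <= I.
  by rewrite -lee_fin -HI; apply: integral_ge0 => x _; rewrite lee_fin powR_ge0.
have [->|In0] := eqVneq I 0; first exact: powR_ge0.
have {In0}I0 : 0 < I by rewrite lt_neqAle eq_sym In0 I0.
pose al := 2 * s / n%:R.
have CI : 0 < C * I `^ al by rewrite mulr_gt0 ?powR_gt0.
have D0 x : (0 <= slice_energy u x)%E.
  by apply: integral_ge0 => y _; rewrite lee_fin mulr_ge0 ?sqr_ge0 ?kernel_frac_ge0.
have H : I <= C * I `^ al * e.
  rewrite -lee_fin -{1}HI [leRHS]EFinM.
  apply: (@le_trans _ _ ((C * I `^ al)%:E * kenergy (kernel_frac s) u)%E); last first.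
    by rewrite lee_pmul2l// lte_fin.
  rewrite kenergyE//; last 2 first.
    by move=> x; exact: kernel_frac_ge0.
    exact: measurable_kernel_frac.
  have mD := measurable_slice_energy mu0.
  rewrite -(@ge0_integralZl _ V R mu setT measurableT (slice_energy u) mD)//; last first.
    by rewrite lee_fin ltW.
  apply: ge0_le_integral => //.
  - by apply/measurable_EFinP; exact: measurable_normr_powR.
  - exact: measurable_funeM.
  - by move=> x _; exact: HC.
have In0 : I != 0 by rewrite gt_eqF.
have H' : I `^ (1 - al) <= C * e.
  rewrite powRB ?In0 ?implybT// powRr1 ?(ltW I0)// ler_pdivrMr ?powR_gt0//.
  by rewrite mulrAC.
have -> : I = (I `^ (1 - al)) `^ (q / 2).
  rewrite -powRrM (_ : (1 - al) * (q / 2) = 1) ?powRr1 ?(ltW I0)//.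
  by rewrite /al /sobolev_exponent; field; rewrite nz nsz.
have q20 : 0 <= q / 2 by apply: divr_ge0 => //; exact: ltW.
apply: ge0_ler_powR; rewrite ?nnegrE ?powR_ge0//.
by rewrite mulr_ge0// ltW.
Qed.

(** The a priori bound applies to the truncations of [u], which are in [L ^ q]
    because they are bounded and square integrable. *)
Theorem sobolev : exists2 C : R, 0 < C & forall (u : V -> R) (e : R),
  measurable_fun setT u -> (\int[mu]_x (u x ^+ 2)%:E < +oo)%E -> 0 <= e ->
  (kenergy (kernel_frac s) u <= e%:E)%E ->
  (\int[mu]_x (`|u x| `^ q)%:E <= ((C * e) `^ (q / 2))%:E)%E.
Proof.
have [C C0 HC] := sobolev_a_priori; exists C => // u e mu0 u2 e0 Ee.
pose g M x : R := (Num.min `|u x| M%:R) `^ q.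
pose t M x : R := truncate M%:R (u x).
have mt M : measurable_fun setT (t M : V -> R).
  by apply: measurable_maxr => //; exact: measurable_minr.
have gE M x : g M x = `|t M x| `^ q by rewrite /g /t normr_truncate.
have mg M : measurable_fun setT (g M : V -> R).
  rewrite (_ : g M = fun x => `|t M x| `^ q); last by apply/funext => x; exact: gE.
  exact: measurable_normr_powR.
have g0 M x : 0 <= g M x by exact: powR_ge0.
have gM M : (\int[mu]_x (g M x)%:E <= ((C * e) `^ (q / 2))%:E)%E.
  have fin : (\int[mu]_x (g M x)%:E < +oo)%E.
    apply: (@le_lt_trans _ _ ((M%:R `^ (q - 2))%:E * \int[mu]_x (u x ^+ 2)%:E)%E); last first.
      by rewrite lte_mul_pinfty// lee_fin powR_ge0.
    apply: (@le_integralZ _ _ R mu setT _ (g M) (fun x => u x ^+ 2)) => //.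
    - exact: measurable_funX.
    - by move=> x; exact: sqr_ge0.
    move=> x _; rewrite /g -[u x ^+ 2]real_normK ?num_real//.
    have m0 : 0 <= Num.min `|u x| M%:R by rewrite le_min normr_ge0 ler0n.
    have -> : q = (q - 2) + 2%:R by ring.
    rewrite powRD; last by apply/implyP => /eqP h; have := q2; lra.
    rewrite powR_mulrn// addrK ler_pM ?powR_ge0 ?exprn_ge0//.
      by apply: ge0_ler_powR; rewrite ?nnegrE ?subr_ge0 ?(ltW q2)// ge_min lexx orbT.
    by rewrite lerXn2r ?nnegrE// ge_min lexx.
  have fE : (\int[mu]_x (`|t M x| `^ q)%:E = (fine (\int[mu]_x (g M x)%:E))%:E)%E.
    under eq_integral do rewrite -gE.
    by rewrite fineK// ge0_fin_numE// integral_ge0// => x _; rewrite lee_fin.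
  have := HC _ _ _ (mt M) e0 fE; rewrite -lee_fin -fE.
  under [in X in _ -> X]eq_integral do rewrite gE.
  apply; apply: le_trans Ee.
  rewrite -[leRHS]mul1e.
  apply: (@le_integralZ _ _ R (mu \x mu)%E setT 1 (energy_density (kernel_frac s) (t M))
    (energy_density (kernel_frac s) u)) => //;
  try (apply: measurable_energy_density => //; exact: measurable_kernel_frac);
  try (by move=> z; apply: energy_density_ge0 => y; exact: kernel_frac_ge0).
  move=> z _; rewrite mul1r ler_wpM2r ?kernel_frac_ge0//.
  rewrite -[leLHS]real_normK ?num_real// -[leRHS]real_normK ?num_real//.
  by rewrite lerXn2r ?nnegrE// truncate_contract.
have g_mono x M N : (M <= N)%N -> g M x <= g N x.
  move=> MN; apply: ge0_ler_powR; rewrite ?nnegrE ?(ltW q0)// ?le_min ?normr_ge0 ?ler0n//.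
  by rewrite !ge_min lexx/= ler_nat MN orbT.
have cvg x : g M x @[M --> \oo] --> `|u x| `^ q.
  apply: cvg_near_cst; exists (Num.truncn `|u x|).+1 => // M /= HM.
  rewrite /g min_l// ltW// (lt_le_trans (truncnS_gt _))// ler_nat.
  by [].
rewrite (_ : (\int[mu]_x (`|u x| `^ q)%:E =
    \int[mu]_x limn (fun M => (g M x)%:E))%E); last first.
  apply: eq_integral => x _; apply/esym/cvg_lim => //.
  by apply: cvg_EFin; [exact: nearW|exact: cvg].
rewrite monotone_convergence//.
- apply: lime_le; last exact: nearW.
  apply: ereal_nondecreasing_is_cvgn => M N MN.
  apply: (@le_integral_EFin _ _ R mu setT (g M) (g N)) => // x _.
  exact: g_mono.
- by move=> M; apply/measurable_EFinP.
- by move=> M x _; rewrite lee_fin.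
by move=> x _ M N MN; rewrite lee_fin g_mono.
Qed.

End sobolev.

(** * Extraction of subsequences *)
(** For a set of indices this is the same as being infinite, in the form needed to
    choose increasing indices. *)
Definition unbounded (A : set nat) := forall N : nat, exists2 k, A k & (N < k)%N.

Lemma unbounded_pigeonhole (T : finType) (f : nat -> T) (A : set nat) :
  unbounded A -> exists c, unbounded (A `&` [set k | f k = c]).
Proof.
move=> uA; apply: contrapT => /forallNP noc.
have bnd c : exists N, forall k, A k -> f k = c -> (k <= N)%N.
  have /existsNP[N HN] := noc c; exists N => k Ak fk.
  by rewrite leqNgt; apply/negP => Nk; apply: HN; exists k.
have [b Hb] := choice bnd.
have [k Ak] := uA (\max_c b c)%N.
by rewrite ltnNge (leq_trans (Hb _ _ Ak erefl))// leq_bigmax.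
Qed.

(** The indices are taken from a decreasing sequence of sets, the [i]-th of which is
    thinned for [P i]. *)
Lemma diagonal_subsequence (P : nat -> nat -> nat -> Prop) :
  (forall i A, unbounded A -> exists B, [/\ unbounded B, B `<=` A &
     forall k l, B k -> B l -> P i k l]) ->
  exists phi : nat -> nat, {homo phi : i j / (i < j)%N} /\
    forall i k l, (i <= k)%N -> (i <= l)%N -> P i (phi k) (phi l).
Proof.
move=> thin.
have /choice[F HF] : forall iA : nat * set nat, exists B, unbounded iA.2 ->
    [/\ unbounded B, B `<=` iA.2 & forall k l, B k -> B l -> P iA.1 k l].
  move=> [i A]; have [uA|nuA] := pselect (unbounded A); last by exists A.
  by have [B HB] := thin i A uA; exists B.
pose fix A (i : nat) : set nat := F (i, if i is j.+1 then A j else setT).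
have uA i : unbounded (A i).
  elim: i => [|i IH].
    by have [] // := HF (0%N, setT) => N /=; exists N.+1.
  by have [] := HF (i.+1, A i) IH.
have PA i k l : A i k -> A i l -> P i k l.
  case: i => [|i].
    by have [|_ _] := HF (0%N, setT); [move=> N /=; exists N.+1|exact].
  by have [_ _] := HF (i.+1, A i) (uA i); exact.
have subA i j : (i <= j)%N -> A j `<=` A i.
  move=> /subnK <-; elim: (j - i)%N => [|m IH]; first by rewrite add0n.
  by have [_ + _] := HF ((m + i).+1, A (m + i)%N) (uA _) => /subset_trans; exact.
have /choice[G HG] : forall iN : nat * nat, exists k, A iN.1 k /\ (iN.2 < k)%N.
  by move=> [i N]; have [k Ak Nk] := uA i N; exists k.
pose fix phi (i : nat) : nat := G (i, if i is j.+1 then phi j else 0%N).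
have Aphi i : A i (phi i).
  by case: i => [|i]; [exact: (HG (0%N, 0%N)).1|exact: (HG (i.+1, phi i)).1].
exists phi; split.
  have phiS i : (phi i < phi i.+1)%N by have [] := HG (i.+1, phi i).
  exact: (homo_ltn ltn_trans phiS).
by move=> i k l ik il; apply: PA; apply: subA (Aphi _).
Qed.

Lemma normr_le_sqr (R : realDomainType) (t b : R) : t ^+ 2 <= b -> `|t| <= b + 1.
Proof.
rewrite -[t ^+ 2]real_normK ?num_real//; move: (normr_ge0 t) (`|t|) => _ p pb.
by have := sqr_ge0 (2 * p - 1); have := sqr_ge0 p; nra.
Qed.

(** * Compactness in the mean square *)
Section mean_square_compactness.
Context {R : realType} (n : nat) (s : R).
Hypotheses (n0 : (0 < n)%N) (s0 : 0 < s).
Local Notation V := 'rV[R]_n.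
Local Notation mu := (lebesgue_rV R n).
Implicit Types u v : V -> R.

Let n0R : 0 < n%:R :> R. Proof. by rewrite ltr0n. Qed.

(** [c] is the value of [u] at some point: the average over [y] of the integral of
    [(u x - u y) ^+ 2] in [x] is at most [j / h ^+ n], so some [y] does not exceed it by
    much. *)
Lemma exists_good_constant (a : V) (h j zeta : R) u : 0 < h -> 0 < zeta ->
  measurable_fun setT u ->
  (\int[mu \x mu]_(z in cube a h `*` cube a h) (osc u z)%:E <= j%:E)%E ->
  exists c : R, (\int[mu]_(x in cube a h) ((u x - c) ^+ 2)%:E <=
    ((j + zeta) / h ^+ n)%:E)%E.
Proof.
move=> h0 zeta0 mu0 Jj; have mQ := measurable_cube a h.
have hn0 : 0 < h ^+ n by exact: exprn_gt0.
apply: contrapT => /forallNP noc.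
move: Jj; rewrite integral_setX//; last 2 first.
- exact: measurable_osc.
- exact: osc_ge0.
apply/negP; rewrite -ltNge.
apply: (@lt_le_trans _ _ (\int[mu]_(x in cube a h) ((j + zeta) / h ^+ n)%:E)%E).
  rewrite (integral_cst_EFin _ mQ (lebesgue_cube a (ltW h0))).
  by rewrite divfK ?gt_eqF// lte_fin ltrDl.
have [jz|jz] := leP 0 (j + zeta); last first.
  apply: (@le_trans _ _ 0%E).
    rewrite (integral_cst_EFin _ mQ (lebesgue_cube a (ltW h0))).
    by rewrite divfK ?gt_eqF// lee_fin ltW.
  by apply: integral_ge0 => x _; apply: integral_ge0 => y _; rewrite lee_fin osc_ge0.
apply: ge0_le_integral => //.
- by move=> x _; rewrite lee_fin divr_ge0// ltW.
- apply: measurable_funTS.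
  rewrite (_ : (fun x => _) =
      fubini_F mu ((EFin \o osc u) \_ (setT `*` cube a h))); last first.
    apply/funext => x; rewrite /fubini_F [LHS]integral_mkcond; apply: eq_integral => y _.
    by rewrite !patchE in_setX in_setT.
  apply: measurable_fun_fubini_tonelli_F.
    apply/(measurable_restrictT _ _).1; first exact: measurableX.
    by apply/measurable_funTS/measurable_EFinP; exact: measurable_osc.
  by move=> z; rewrite patchE; case: ifP => // _; rewrite lee_fin osc_ge0.
move=> x Qx; have := noc (u x) => /negP; rewrite -ltNge => /ltW/le_trans; apply.
rewrite le_eqVlt; apply/orP; left; apply/eqP; apply: eq_integral => y _.
by rewrite /osc /= -sqrrN opprB.
Qed.

(** On a cube the kernel is at least [(n h) ^ (- n - 2 s)], and averaging costs
    [h ^ (- n)]: a factor [h ^ (2 s)] remains. The energies of the diagonal blocks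
    add up to at most [M]. *)
Lemma grid_constants (a : V) (h M : R) N u : 0 < h -> 0 <= M ->
  measurable_fun setT u -> (kenergy (kernel_frac s) u <= M%:E)%E ->
  exists c : {ffun 'I_n -> 'I_N.+1} -> R,
  (\sum_f \int[mu]_(x in cube (grid_vertex a h f) h) ((u x - c f) ^+ 2)%:E
   <= (n%:R `^ (n%:R + 2 * s) * (M + 1) * h `^ (2 * s))%:E)%E.
Proof.
move=> h0 M0 mu0 EM; pose F : finType := ({ffun 'I_n -> 'I_N.+1} : finType).
pose Q (f : F) := cube (grid_vertex a h f) h.
pose E (f : F) : \bar R :=
  (\int[mu \x mu]_(z in Q f `*` Q f) (energy_density (kernel_frac s) u z)%:E)%E.
have k0 (z : V) : 0 <= kernel_frac s z by exact: kernel_frac_ge0.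
have mk := @measurable_kernel_frac R n s.
have mQ f : measurable (Q f) by exact: measurable_cube.
have mQQ f : measurable (Q f `*` Q f) by exact: measurableX.
have mE := measurable_energy_density mk mu0.
have E0 f : (0 <= E f)%E.
  by apply: integral_ge0 => z _; rewrite lee_fin energy_density_ge0.
have sumE : (\sum_f E f <= M%:E)%E.
  apply: le_trans EM; rewrite -ge0_integral_bigsetU//.
  - apply: (@subset_integral_EFin _ _ R (mu \x mu)%E _ setT
      (energy_density (kernel_frac s) u)) => //.
      by apply: bigsetU_measurable => f _.
    by move=> z; exact: energy_density_ge0.
  - exact: index_enum_uniq.
  - move=> f g _ _ [[x y] [[/= xf _] [/= xg _]]].
    by apply: (@grid_trivIset R n a h N h0 f g) => //; exists x.
  - by apply/measurable_EFinP; exact: measurable_funTS.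
  - by move=> z _; rewrite lee_fin energy_density_ge0.
have Efin f : E f \is a fin_num.
  rewrite ge0_fin_numE// (@le_lt_trans _ _ M%:E) ?ltry//.
  apply: le_trans sumE; rewrite (bigD1 f)//= leeDl//.
  exact: sume_ge0.
pose e f : R := fine (E f).
have eE f : E f = (e f)%:E by rewrite fineK.
have sume : \sum_f e f <= M.
  by rewrite -lee_fin -sumEFin; under eq_bigr do rewrite -eE.
pose D : R := (n%:R * h) `^ (n%:R + 2 * s).
have D0 : 0 < D by rewrite powR_gt0 ?mulr_gt0.
have J f : (\int[mu \x mu]_(z in Q f `*` Q f) (osc u z)%:E <= (D * e f)%:E)%E.
  rewrite EFinM -eE -[D]invrK.
  apply: integral_osc_le_energy => //; first by rewrite invr_gt0.
  move=> [x y] [/= xQ yQ] xy; rewrite lef_pV2 ?posrE//; last first.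
    by rewrite powR_gt0 ?enorm_gt0// subr_eq0.
  apply: ge0_ler_powR; rewrite ?nnegrE ?enorm_ge0// ?mulr_ge0 ?(ltW h0)//.
    by rewrite addr_ge0// mulr_ge0// ltW.
  exact: cube_diam xQ yQ.
have F0 : (0 < #|F|)%N by apply/card_gt0P; exists [ffun=> ord0].
have F0R : 0 < #|F|%:R :> R by rewrite ltr0n.
(* the slack zeta, small enough for the sum over all cubes to be D *)
have z0 : 0 < D / #|F|%:R by rewrite divr_gt0.
have [c Hc] := choice (fun f => exists_good_constant h0 z0 mu0 (J f)).
exists c; apply: (@le_trans _ _ (\sum_f ((D * e f + D / #|F|%:R) / h ^+ n)%:E)%E).
  by apply: lee_sum => f _; exact: Hc.
rewrite sumEFin lee_fin -mulr_suml big_split/= -mulr_sumr sumr_const.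
rewrite -[_ *+ _]mulr_natr divfK ?gt_eqF//.
have hn0 : 0 < h ^+ n by exact: exprn_gt0.
rewrite ler_pdivrMr//.
have -> : n%:R `^ (n%:R + 2 * s) * (M + 1) * h `^ (2 * s) * h ^+ n = D * (M + 1).
  rewrite /D powRM ?(ltW n0R) ?(ltW h0)// [h `^ (_ + _)]powRD ?(gt_eqF h0) ?implybT//.
  by rewrite powR_mulrn ?(ltW h0)//; ring.
by rewrite mulrDr mulr1 lerD2r ler_wpM2l// ltW.
Qed.

Lemma integral_sqrB_le_grid (Omega : set V) (K h delta eta : R) N u v
    (c d : {ffun 'I_n -> 'I_N.+1} -> R) :
  Omega `<=` ccube 0 K -> 0 < h -> N.+1%:R * h = 2 * K ->
  measurable_fun setT u -> measurable_fun setT v ->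
  zero_outside Omega u -> zero_outside Omega v ->
  (\sum_f \int[mu]_(x in cube (grid_vertex (0 - const_mx K) h f) h)
     ((u x - c f) ^+ 2)%:E <= delta%:E)%E ->
  (\sum_f \int[mu]_(x in cube (grid_vertex (0 - const_mx K) h f) h)
     ((v x - d f) ^+ 2)%:E <= delta%:E)%E ->
  (forall f, `|c f - d f| <= eta) ->
  (\int[mu]_x ((u x - v x) ^+ 2)%:E <=
   (6 * delta + 3 * eta ^+ 2 * (2 * K) ^+ n)%:E)%E.
Proof.
move=> OK h0 Nh mu0 mv zu zv Hu Hv cd.
have mB (w : V -> R) (b : R) : measurable_fun setT w ->
    measurable_fun setT (fun x => (w x - b) ^+ 2).
  by move=> mw; apply: measurable_funX; exact: measurable_funB.
have muv : measurable_fun setT (fun x => (u x - v x) ^+ 2).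
  by apply: measurable_funX; exact: measurable_funB.
rewrite (@integral_zero_outsideT _ _ Omega (ccube 0 K))//; last 3 first.
- exact: measurable_ccube.
- by move=> x; exact: sqr_ge0.
- apply: filterS2 zu zv => x zux zvx Ox.
  by rewrite zux// zvx// subrr expr0n.
rewrite /ccube -Nh integral_grid//; last by move=> x; exact: sqr_ge0.
pose Q (f : {ffun 'I_n -> 'I_N.+1}) := cube (grid_vertex (0 - const_mx K) h f) h.
pose U f : \bar R := (\int[mu]_(x in Q f) ((u x - c f) ^+ 2)%:E)%E.
pose W f : \bar R := (\int[mu]_(x in Q f) ((v x - d f) ^+ 2)%:E)%E.
have U0 f : (0 <= U f)%E by apply: integral_ge0 => x _; rewrite lee_fin sqr_ge0.
have W0 f : (0 <= W f)%E by apply: integral_ge0 => x _; rewrite lee_fin sqr_ge0.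
have step f : (\int[mu]_(x in Q f) ((u x - v x) ^+ 2)%:E <=
    3%:E * (U f + W f) + (3 * eta ^+ 2 * h ^+ n)%:E)%E.
  have mQ : measurable (Q f) by exact: measurable_cube.
  apply: (@le_trans _ _ (3%:E * \int[mu]_(x in Q f)
        (1 * (u x - c f) ^+ 2 + 1 * (v x - d f) ^+ 2)%:E +
      (3 * eta ^+ 2)%:E * \int[mu]_(x in Q f) (cst 1 x)%:E)%E).
    apply: (@le_integral_lin _ _ R mu (Q f) 3 (3 * eta ^+ 2)
      (fun x => (u x - v x) ^+ 2)
      (fun x => 1 * (u x - c f) ^+ 2 + 1 * (v x - d f) ^+ 2) (cst 1)) => //.
    - by rewrite mulr_ge0// sqr_ge0.
    - by apply: measurable_funD; apply: measurable_funM => //; exact: mB.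
    - by move=> x; exact: sqr_ge0.
    - by move=> x; rewrite addr_ge0// mul1r sqr_ge0.
    move=> x _ /=; rewrite mulr1 !mul1r.
    have : (c f - d f) ^+ 2 <= eta ^+ 2.
      by rewrite -[leLHS]real_normK ?num_real// lerXn2r ?nnegrE// (le_trans _ (cd f)).
    move: (u x) (v x) (c f) (d f) (eta ^+ 2) => p p' b b' e2 H.
    have := sqr_ge0 ((p - b) + (p' - b')).
    have := sqr_ge0 ((p - b) - (b - b')).
    have := sqr_ge0 ((p' - b') + (b - b')).
    nra.
  rewrite integral_EFin_lin ?ler01//; try exact: mB; try by move=> x; exact: sqr_ge0.
  rewrite !mul1e leeD2l//.
  rewrite /= (integral_cst_EFin 1 mQ (lebesgue_cube _ (ltW h0))) mul1r -EFinM.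
  by [].
apply: (le_trans (lee_sum _ (fun f _ => step f))).
rewrite big_split/= -ge0_sume_distrr//; last first.
  by move=> f _; rewrite adde_ge0.
rewrite [leRHS]EFinD; apply: leeD.
  have -> : 6 * delta = 3 * (delta + delta) by ring.
  by rewrite EFinM lee_pmul2l ?lte_fin// big_split/= [leRHS]EFinD; apply: leeD.
rewrite sumEFin lee_fin sumr_const card_ffun !card_ord exprMn.
by rewrite -[_ *+ _]mulr_natr natrX -!mulrA [h ^+ n * _]mulrC.
Qed.

(** On a fine grid every function is close to a step function whose values are
    bounded. Rounding these values leaves finitely many step functions, one of which
    serves infinitely many indices. *)
Lemma mean_square_precompact (Omega : set V) (M M2 : R) (u_ : nat -> V -> R) :
  bounded_set Omega -> 0 <= M -> 0 <= M2 ->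
  (forall k, measurable_fun setT (u_ k)) -> (forall k, zero_outside Omega (u_ k)) ->
  (forall k, kenergy (kernel_frac s) (u_ k) <= M%:E)%E ->
  (forall k, \int[mu]_x (u_ k x ^+ 2)%:E <= M2%:E)%E ->
  forall (eps : R) A, 0 < eps -> unbounded A ->
  exists B, [/\ unbounded B, B `<=` A & forall k l, B k -> B l ->
    (\int[mu]_x ((u_ k x - u_ l x) ^+ 2)%:E <= eps%:E)%E].
Proof.
move=> bO M0 M20 mu_ zu_ EM IM eps A eps0 uA.
have [K K0 OK] := bounded_set_ccube bO.
pose D : R := n%:R `^ (n%:R + 2 * s) * (M + 1).
have D0 : 0 < D by rewrite mulr_gt0 ?powR_gt0// ltr_wpDl.
pose tau : R := eps / (12 * D); have tau0 : 0 < tau by rewrite divr_gt0// mulr_gt0.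
pose N := Num.truncn (2 * K / tau `^ (2 * s)^-1).
have N0 : 0 < N.+1%:R :> R by rewrite ltr0n.
pose h : R := 2 * K / N.+1%:R.
have h0 : 0 < h by rewrite divr_gt0// mulr_gt0.
have Nh : N.+1%:R * h = 2 * K by rewrite /h mulrC divfK// gt_eqF.
pose delta : R := D * h `^ (2 * s).
have delta_le : 6 * delta <= eps / 2.
  have htau : h `^ (2 * s) <= tau.
    have -> : tau = (tau `^ (2 * s)^-1) `^ (2 * s).
      by rewrite -powRrM mulVf ?powRr1 ?(ltW tau0)// gt_eqF// mulr_gt0.
    apply: ge0_ler_powR; rewrite ?nnegrE ?powR_ge0 ?(ltW h0)//.
      by rewrite mulr_ge0// ltW.
    have tp : 0 < tau `^ (2 * s)^-1 by exact: powR_gt0.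
    rewrite ler_pdivrMr// [leRHS]mulrC -ler_pdivrMr//; exact/ltW/truncnS_gt.
  have -> : eps / 2 = 6 * (D * tau) by rewrite /tau; field; rewrite gt_eqF.
  by rewrite ler_pM2l// ler_wpM2l// ltW.
have [c Hc] := choice (fun k => @grid_constants (0 - const_mx K) h M N (u_ k)
  h0 M0 (mu_ k) (EM k)).
have d0 : 0 <= delta by rewrite mulr_ge0 ?powR_ge0// ltW.
have hn0 : 0 < h ^+ n by exact: exprn_gt0.
(* on each cube, c ^+ 2 is at most twice (u - c) ^+ 2 plus twice u ^+ 2 *)
pose B : R := (2 * delta + 2 * M2) / h ^+ n; pose Lam : R := B + 1.
have B0 : 0 <= B.
  by apply: divr_ge0; [apply: addr_ge0; apply: mulr_ge0|exact: ltW].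
have cB k f : `|c k f| <= Lam.
  have mQ := measurable_cube (grid_vertex (0 - const_mx K) h f) h.
  have muQ := lebesgue_cube (grid_vertex (0 - const_mx K) h f) (ltW h0).
  have m1 : measurable_fun setT (fun x => (u_ k x - c k f) ^+ 2).
    by apply: measurable_funX; exact: measurable_funB.
  have m2 : measurable_fun setT (fun x => u_ k x ^+ 2) by exact: measurable_funX.
  suff : c k f ^+ 2 <= B by exact: normr_le_sqr.
  rewrite ler_pdivlMr// -lee_fin -(integral_cst_EFin _ mQ muQ) EFinD !EFinM.
  apply: (@le_trans _ _ (2%:E * \int[mu]_(x in cube (grid_vertex (0 - const_mx K) h f) h)
        ((u_ k x - c k f) ^+ 2)%:E
    + 2%:E * \int[mu]_(x in cube (grid_vertex (0 - const_mx K) h f) h)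
        (u_ k x ^+ 2)%:E)%E).
    apply: (@le_integral_lin _ _ R mu _ 2 2 (cst (c k f ^+ 2))
       (fun x => (u_ k x - c k f) ^+ 2) (fun x => u_ k x ^+ 2)) => //;
      try by move=> x; exact: sqr_ge0.
    move=> x _ /=; move: (u_ k x) (c k f) => p q.
    by have := sqr_ge0 (2 * p - q); nra.
  apply: leeD; rewrite lee_pmul2l ?lte_fin//.
    apply: le_trans (Hc k); rewrite (bigD1 f)//= leeDl// sume_ge0// => g _.
    by apply: integral_ge0 => x _; rewrite lee_fin sqr_ge0.
  apply: le_trans (IM k).
  by apply: (@subset_integral_EFin _ _ R mu _ setT (fun x => u_ k x ^+ 2)) => // x; exact: sqr_ge0.
pose kap : R := 3 * (2 * K) ^+ n.
have kap0 : 0 < kap by rewrite mulr_gt0// exprn_gt0// mulr_gt0.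
pose eta : R := Num.min 1 (eps / (2 * kap)).
have eta0 : 0 < eta by rewrite lt_min ltr01 divr_gt0// mulr_gt0.
have eta_le : 3 * eta ^+ 2 * (2 * K) ^+ n <= eps / 2.
  have -> : 3 * eta ^+ 2 * (2 * K) ^+ n = eta ^+ 2 * kap by rewrite /kap; ring.
  rewrite -ler_pdivlMr// (@le_trans _ _ eta)//.
    by rewrite expr2 ler_piMl ?(ltW eta0)// ge_min lexx.
  by rewrite ge_min -mulrA -invfM lexx orbT.
pose L := Num.truncn (2 * Lam / eta).
have Lam0 : 0 <= Lam by rewrite addr_ge0.
pose b k : {ffun {ffun 'I_n -> 'I_N.+1} -> 'I_L.+1} :=
  [ffun f => inord (Num.truncn ((c k f + Lam) / eta))].
have [b0 ub0] := unbounded_pigeonhole b uA.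
exists (A `&` [set k | b k = b0]); split => //.
have bin k f : b k = b0 -> (b0 f)%:R * eta <= c k f + Lam < ((b0 f)%:R + 1) * eta.
  move=> <-; rewrite ffunE.
  have ck := cB k f; rewrite ler_norml in ck.
  have t0 : 0 <= (c k f + Lam) / eta by rewrite divr_ge0 ?(ltW eta0)//; lra.
  rewrite inordK; last first.
    rewrite ltnS le_truncn// ler_wpM2r ?invr_ge0 ?(ltW eta0)//; lra.
  by have /andP[] := truncn_itv t0; rewrite -natr1 ler_pdivlMr// ltr_pdivrMr// => -> ->.
move=> k l [_ bk] [_ bl].
apply: (le_trans (@integral_sqrB_le_grid Omega K h delta eta N (u_ k) (u_ l)
  (c k) (c l) _ _ _ _ _ _ _ _ _ _)) => //.
  move=> f; have := bin k f bk; have := bin l f bl.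
  by rewrite ler_norml; move: (b0 f)%:R => m; nra.
by rewrite lee_fin; lra.
Qed.

End mean_square_compactness.

(** * Convergence in L^p *)
Section Lp_limits.
Context d (T : measurableType d) (R : realType).
Variable mu : {measure set T -> \bar R}.
Variables (Omega : set T) (b q : R).
Hypotheses (mO : measurable Omega) (b0 : 0 <= b) (muO : (mu Omega <= b%:E)%E).
Hypothesis q1 : 1 <= q.

Let q0 : 0 < q. Proof. exact: lt_le_trans q1. Qed.

Definition vanishes_outside (w : T -> R) := forall x, ~ Omega x -> w x = 0.

Lemma integral_vanishes_outside (w : T -> R) (p : R) : 0 < p -> vanishes_outside w ->
  (\int[mu]_x (`|w x| `^ p)%:E = \int[mu]_(x in Omega) (`|w x| `^ p)%:E)%E.
Proof.
move=> p0 wO; rewrite [RHS]integral_mkcond; apply: eq_integral => x _.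
rewrite patchE; case: ifPn => //; rewrite notin_setE => /wO ->.
by rewrite normr0 powR0// gt_eqF.
Qed.

(** [powR_interpolate] at height [lam], integrated over a set of finite measure. *)
Lemma integral_powR_le (w : T -> R) (p lam : R) : 0 < p -> p <= q -> 0 < lam ->
  measurable_fun setT w -> vanishes_outside w ->
  (\int[mu]_x (`|w x| `^ q)%:E <= (lam `^ q)%:E)%E ->
  (\int[mu]_x (`|w x| `^ p)%:E <= (lam `^ p * (1 + b))%:E)%E.
Proof.
move=> p0 pq l0 mw wO; rewrite !integral_vanishes_outside// => H.
apply: (@le_trans _ _ ((lam `^ (p - q))%:E * \int[mu]_(x in Omega) (`|w x| `^ q)%:E
   + (lam `^ p)%:E * \int[mu]_(x in Omega) (cst 1 x)%:E)%E).
  apply: (@le_integral_lin _ _ R mu Omega (lam `^ (p - q)) (lam `^ p)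
    (fun x => `|w x| `^ p) (fun x => `|w x| `^ q) (cst 1)) => //;
    try exact: powR_ge0; try exact: measurable_normr_powR;
    try by move=> x; exact: powR_ge0.
  by move=> x _ /=; rewrite mulr1 powR_interpolate.
have -> : lam `^ p * (1 + b) = lam `^ (p - q) * lam `^ q + lam `^ p * b.
  by rewrite -powRD ?(gt_eqF l0) ?implybT// subrK; ring.
rewrite [leRHS]EFinD; apply: leeD.
  by rewrite EFinM lee_wpmul2l// lee_fin powR_ge0.
rewrite EFinM lee_wpmul2l ?lee_fin ?powR_ge0//.
rewrite (_ : integral _ _ _ = mu Omega)// -[RHS]mul1e.
exact: (integral_cst mu mO 1%E).
Qed.

(** Zero is reached as a limit of positive values of [lam], for which
    [integral_powR_le] applies. *)
Lemma Lnorm_le (w : T -> R) (p lam : R) : 0 < p -> p <= q -> 0 <= lam ->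
  measurable_fun setT w -> vanishes_outside w ->
  (\int[mu]_x (`|w x| `^ q)%:E <= (lam `^ q)%:E)%E ->
  ('N[mu]_p%:E[EFin \o w] <= (lam * (1 + b) `^ p^-1)%:E)%E.
Proof.
move=> p0 pq l0 mw wO H; have b10 : 0 < 1 + b by rewrite ltr_wpDr.
have main t : 0 < t -> lam <= t ->
    ('N[mu]_p%:E[EFin \o w] <= (t * (1 + b) `^ p^-1)%:E)%E.
  move=> t0 lt; rewrite unlock /=.
  have -> : t * (1 + b) `^ p^-1 = (t `^ p * (1 + b)) `^ p^-1.
    rewrite powRM ?powR_ge0 ?(ltW b10)// -powRrM mulfV ?gt_eqF//.
    by rewrite powRr1 ?(ltW t0).
  rewrite -poweR_EFin; apply: gt0_ler_poweR.
  - by rewrite invr_ge0 ltW.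
  - by rewrite in_itv/= leey andbT integral_ge0// => x _; rewrite poweR_ge0.
  - by rewrite in_itv/= leey andbT lee_fin mulr_ge0 ?powR_ge0// ltW.
  apply: integral_powR_le => //; apply: (le_trans H); rewrite lee_fin.
  by apply: ge0_ler_powR; rewrite ?nnegrE ?(ltW q0)// ltW.
have {l0} := l0; rewrite le_eqVlt => /predU1P[l0|l0]; last exact: main.
rewrite -l0 mul0r; apply/lee_addgt0Pr => e e0; rewrite add0e.
have := main (e / (1 + b) `^ p^-1); rewrite divfK ?gt_eqF ?powR_gt0//; apply.
  by rewrite divr_gt0 ?powR_gt0.
by rewrite -l0 divr_ge0 ?powR_ge0// ltW.
Qed.

Lemma limn_einf_le (a : (\bar R)^nat) (M : \bar R) i :
  (forall l, (i <= l)%N -> (a l <= M)%E) -> (limn_einf a <= M)%E.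
Proof.
move=> aM; rewrite limn_einf_lim; apply: lime_le; first exact: is_cvg_einfs.
apply: nearW => m; apply: (le_trans _ (aM (maxn m i) (leq_maxr _ _))).
by apply: ereal_inf_lbound; exists (maxn m i) => //=; exact: leq_maxl.
Qed.

Lemma limn_einf_ge0 (a : (\bar R)^nat) : (forall l, (0 <= a l)%E) ->
  (0 <= limn_einf a)%E.
Proof.
move=> a0; rewrite limn_einf_lim; apply: lime_ge; first exact: is_cvg_einfs.
by apply: nearW => m; apply: le_ereal_inf_tmp => _ [l _ <-].
Qed.

(** Continuity of the power at a positive limit; at [0] the left-hand side is [0]. *)
Lemma normr_powR_lsc (t : nat -> R) (t0 a : R) : t l @[l --> \oo] --> t0 ->
  ((`|a - t0| `^ q)%:E <= limn_einf (fun l => (`|a - t l| `^ q)%:E))%E.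
Proof.
move=> tt0; have [->|at0] := eqVneq (a - t0) 0.
  rewrite normr0 powR0 ?gt_eqF//; apply: limn_einf_ge0 => l.
  by rewrite lee_fin powR_ge0.
suff H : (`|a - t l| `^ q)%:E @[l --> \oo] --> (`|a - t0| `^ q)%:E.
  by rewrite (cvg_limn_einf_sup H).1.
apply: cvg_EFin; first exact: nearW.
have cn : `|a - t l| @[l --> \oo] --> `|a - t0|.
  by apply: cvg_norm; apply: cvgB => //; exact: cvg_cst.
apply: (@cvg_comp _ _ _ (fun l => `|a - t l|) (fun x => x `^ q) _ _ _ cn).
apply: (@differentiable_continuous R R R _ (fun x : R => x `^ q)).
apply/derivable1_diffP; apply: derivable_powR.
by rewrite in_itv/= andbT normr_gt0.
Qed.

(** Riesz-Fischer: the increments are summable in [L ^ 1], so the sequence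
    converges almost everywhere, and Fatou's lemma bounds the distance to the
    limit. *)
Lemma fast_cauchy_limit (w : nat -> T -> R) :
  (forall k, measurable_fun setT (w k)) -> (forall k, vanishes_outside (w k)) ->
  (forall i k l, (i <= k)%N -> (i <= l)%N ->
    (\int[mu]_x (`|w k x - w l x| `^ q)%:E <= ((2^-1 ^+ i) `^ q)%:E)%E) ->
  exists v : T -> R, [/\ measurable_fun setT v, vanishes_outside v &
   forall i, (\int[mu]_x (`|w i x - v x| `^ q)%:E <= ((2^-1 ^+ i) `^ q)%:E)%E].
Proof.
move=> mw wO cw.
have h0 i : 0 < 2^-1 ^+ i :> R by rewrite exprn_gt0// invr_gt0.
have mB k l : measurable_fun setT (fun x => w k x - w l x) by exact: measurable_funB.
pose D i x : R := `|w i.+1 x - w i x|.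
have D0 i x : 0 <= D i x by exact: normr_ge0.
have mD i : measurable_fun setT (D i).
  by apply: (measurableT_comp (@normr_measurable R setT)); exact: mB.
pose v x : R := fine (limn_esup (fun i => (w i x)%:E)).
have mv : measurable_fun setT v.
  apply: (measurableT_comp (f := fine)) => //.
  by apply: measurable_fun_limn_esup => i; apply/measurable_EFinP.
have cvgv x : cvgn (w^~ x) -> w k x @[k --> \oo] --> v x.
  move=> cx; have H : (w k x)%:E @[k --> \oo] --> (limn (w^~ x))%:E.
    by apply: cvg_EFin => //; exact: nearW.
  by rewrite /v (cvg_limn_einf_sup H).2.
have DI i : (\int[mu]_x (D i x)%:E <= ((1 + b) * 2^-1 ^+ i)%:E)%E.
  have wOi : vanishes_outside (fun x => w i.+1 x - w i x).
    by move=> x Ox; rewrite !wO// subrr.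
  have := integral_powR_le ltr01 q1 (h0 i) (mB i.+1 i) wOi
    (cw i i.+1 i (leqnSn i) (leqnn i)).
  rewrite powRr1 ?(ltW (h0 i))// mulrC.
  by under eq_integral do rewrite powRr1//.
have aecvg : {ae mu, forall x, w k x @[k --> \oo] --> v x}.
  pose S x : \bar R := (\sum_(i <oo) (D i x)%:E)%E.
  have mS : measurable_fun setT S.
    apply: ge0_emeasurable_sum => i; first by move=> x _ _; rewrite lee_fin.
    by move=> _; apply/measurable_EFinP.
  have S0 x : (0 <= S x)%E by apply: nneseries_ge0 => i _ _; rewrite lee_fin.
  have iS : mu.-integrable setT S.
    apply/integrableP; split => //.
    under eq_integral do rewrite gee0_abs//.
    rewrite integral_nneseries//; last 2 first.
    - by move=> i; apply/measurable_EFinP.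
    - by move=> i x _; rewrite lee_fin.
    apply: (@le_lt_trans _ _ ((1 + b) / (1 - 2^-1))%:E); last exact: ltry.
    apply: nneseries_geometric_le => //.
    - by rewrite addr_ge0.
    - by rewrite invr_ge0 ler0n invf_lt1// ltr1n.
    - by move=> i; apply: integral_ge0 => x _; rewrite lee_fin.
  have := integrable_ae measurableT iS; apply: filterS => x /(_ I) finS.
  apply: cvgv.
  have cD : cvgn (series (D^~ x)).
    apply: nondecreasing_is_cvgn.
      by apply: nondecreasing_series => i _ _; exact: normr_ge0.
    exists (fine (S x)) => _ [m _ <-].
    rewrite -lee_fin fineK// seriesEnat /= -sumEFin.
    apply: (@nneseries_lim_ge _ (fun i => (D i x)%:E) xpredT 0 m) => i _ _.
    by rewrite lee_fin.
  have cT : cvgn (series (telescope (w^~ x))) by apply: normed_cvg; exact: cD.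
  rewrite (_ : w^~ x = fun m => w 0%N x + series (telescope (w^~ x)) m); last first.
    by apply/funext => m; exact: (eq_sum_telescope (w^~ x)).
  by apply: is_cvgD => //; exact: is_cvg_cst.
exists v; split => //.
  move=> x Ox; rewrite /v (_ : (fun i => _) = cst 0%E).
    have H : (cst 0%E : nat -> \bar R) k @[k --> \oo] --> 0%E by exact: cvg_cst.
    by rewrite (cvg_limn_einf_sup H).2.
  by apply/funext => i; rewrite wO.
move=> i; pose f l x : \bar R := (`|w i x - w l x| `^ q)%:E.
have mf l : measurable_fun setT (f l).
  by apply/measurable_EFinP; apply: measurable_normr_powR; exact: mB.
have f0 l x : setT x -> (0 <= f l x)%E by move=> _; rewrite lee_fin powR_ge0.
apply: (@le_trans _ _ (\int[mu]_x (limn_einf (f^~ x)))%E).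
  apply: ae_ge0_le_integral => //.
  - by apply/measurable_EFinP; apply: measurable_normr_powR; exact: measurable_funB.
  - by move=> x _; apply: limn_einf_ge0 => l; exact: f0.
  - rewrite (_ : (fun x => _) = fun x => (- limn_esup (fun l => - f l x))%E).
      apply: measurableT_comp => //.
      by apply: measurable_fun_limn_esup => l; apply: measurableT_comp.
    by apply/funext => x; rewrite limn_esupN oppeK.
  by apply: filterS aecvg => x cx _; exact: normr_powR_lsc.
apply: (le_trans (fatou mu measurableT mf f0)).
by apply: (limn_einf_le (i := i)) => l il; exact: cw.
Qed.

End Lp_limits.

(** * Comparison of the energies *)
Section logarithmic_energy.
Context {R : realType} (n : nat) (s : R) (Omega : set 'rV[R]_n).
Hypotheses (n0 : (0 < n)%N) (s01 : 0 < s < 1) (bO : bounded_set Omega).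
Local Notation V := 'rV[R]_n.
Local Notation mu := (lebesgue_rV R n).
Implicit Types u v : V -> R.

Let s0 : 0 < s. Proof. by case/andP: s01. Qed.
Let c0 : 0 < cns n s. Proof. exact: cns_gt0. Qed.

Lemma poincare_log : exists2 C : R, 0 <= C & forall u,
  measurable_fun setT u -> zero_outside Omega u ->
  (\int[mu]_x (u x ^+ 2)%:E <= C%:E * kenergy (kernel_log s) u)%E.
Proof.
have [K K0 OK] := bounded_set_ccube bO.
apply: (@poincare R n Omega K (kernel_log s) (cns n s * ln 2) 2^-1) => //.
- by move=> z; exact: kernel_log_ge0.
- exact: measurable_kernel_log.
- by rewrite mulr_gt0// ln_gt0// ltr1n.
- by move=> z z0 z2; exact: kernel_log_ge.
Qed.

(** Split the fractional energy at [|x - y| = expR (- L)]; [L] is free, so the first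
    constant can be made as small as desired, at the expense of the second. *)
Lemma kenergy_frac_le_log (L : R) : 0 < L -> exists2 C : R, 0 <= C & forall u,
  measurable_fun setT u ->
  (kenergy (kernel_frac s) u <= (cns n s * L)^-1%:E * kenergy (kernel_log s) u
     + C%:E * \int[mu]_x (u x ^+ 2)%:E)%E.
Proof.
move=> L0; have [C C0 HC] := @kenergy_far R n s (expR (- L)) s0 (expR_gt0 _).
exists C => // u mu0; apply: (@le_trans _ _
  ((cns n s * L)^-1%:E * kenergy (kernel_log s) u +
   1%:E * kenergy (far_kernel s (expR (- L))) u)%E).
  apply: kenergy_le_lin => //.
  - by rewrite invr_ge0 mulr_ge0// ltW.
  - exact: kernel_frac_ge0.
  - exact: kernel_log_ge0.
  - exact: far_kernel_ge0.
  - exact: measurable_kernel_frac.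
  - exact: measurable_kernel_log.
  - exact: measurable_far_kernel.
  - by move=> z z0; exact: kernel_frac_le_log.
by apply: leeD => //; rewrite mul1e; exact: HC.
Qed.

Lemma kenergy_frac_le_log_bounded : exists2 C : R, 0 < C & forall u,
  measurable_fun setT u -> zero_outside Omega u ->
  (kenergy (kernel_frac s) u <= C%:E * kenergy (kernel_log s) u)%E.
Proof.
have [C1 C10 H1] := kenergy_frac_le_log ltr01.
have [C2 C20 H2] := poincare_log.
have c1 : 0 < (cns n s * 1)^-1 by rewrite invr_gt0 mulr1.
exists ((cns n s * 1)^-1 + C1 * C2) => [|u mu0 zu].
  by rewrite ltr_wpDr// mulr_ge0.
have E0 : (0 <= kenergy (kernel_log s) u)%E.
  by apply: kenergy_ge0 => z; exact: kernel_log_ge0.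
apply: (le_trans (H1 u mu0)).
rewrite [in leRHS]EFinD [leRHS]ge0_muleDl ?lee_fin ?(ltW c1) ?mulr_ge0//.
by rewrite leeD2l// EFinM -muleA lee_wpmul2l ?lee_fin// H2.
Qed.

Lemma kenergy_log_le_frac (eps : R) : 0 < eps -> forall u, measurable_fun setT u ->
  (kenergy (kernel_log s) u <=
   (cns n s / (2 * eps))%:E * kenergy (kernel_frac (s + eps)) u)%E.
Proof.
move=> e0 u mu0; have ce : 0 <= cns n s / (2 * eps).
  by apply: divr_ge0; [exact: ltW|rewrite mulr_ge0// ltW].
have := @kenergy_le_lin R n (cns n s / (2 * eps)) 0 (kernel_log s)
  (kernel_frac (s + eps)) (kernel_log s) u ce (lexx _).
rewrite mul0e adde0; apply => //.
- by move=> z; exact: kernel_log_ge0.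
- by move=> z; exact: kernel_frac_ge0.
- by move=> z; exact: kernel_log_ge0.
- exact: measurable_kernel_log.
- exact: measurable_kernel_frac.
- exact: measurable_kernel_log.
- by move=> z z0; rewrite mul0r addr0; exact: kernel_log_le_frac.
Qed.

Lemma kenergyB_le (k : V -> R) u v : (forall z, 0 <= k z) -> measurable_fun setT k ->
  measurable_fun setT u -> measurable_fun setT v ->
  (kenergy k (fun x => (u x - v x)%R) <= 2%:E * kenergy k u + 2%:E * kenergy k v)%E.
Proof.
move=> k0 mk mu0 mv.
apply: (@le_integral_lin _ _ R (mu \x mu)%E setT 2 2
  (energy_density k (fun x => u x - v x)) (energy_density k u) (energy_density k v)) => //;
  try (by apply: measurable_energy_density => //; exact: measurable_funB);
  try by move=> z; exact: energy_density_ge0.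
move=> [x y] _; rewrite /energy_density /=.
move: (k0 (x - y)); move: (k (x - y)) (u x) (u y) (v x) (v y) => t a a' b b' t0.
rewrite !mulrA -mulrDl ler_wpM2r//.
by have := sqr_ge0 ((a - a') + (b - b')); nra.
Qed.

(** * Compactness in the critical space *)
(** [L] is fixed first, from the bound on the energies: it makes the near part of
    the energy of all differences small. The constant of the far part is then known,
    and compactness in the mean square takes care of it. *)
Lemma critical_precompact (u_ : nat -> V -> R) (M : R) :
  2 * s < n%:R -> 0 <= M ->
  (forall k, measurable_fun setT (u_ k)) -> (forall k, zero_outside Omega (u_ k)) ->
  (forall k, kenergy (kernel_log s) (u_ k) <= M%:E)%E ->
  forall (eps : R) A, 0 < eps -> unbounded A ->
  exists B, [/\ unbounded B, B `<=` A & forall k l, B k -> B l ->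
    (\int[mu]_x (`|u_ k x - u_ l x| `^ sobolev_exponent n s)%:E <= eps%:E)%E].
Proof.
move=> sn M0 mu_ zu_ EM eps A eps0 uA.
have q2 := sobolev_exponent_gt2 s01 sn.
set q := sobolev_exponent n s in q2 *.
have q0 : 0 < q by exact: lt_trans q2.
have [CS CS0 HS] := sobolev n0 s01 sn.
have [C1 C10 H1] := kenergy_frac_le_log_bounded.
have [C2 C20 H2] := poincare_log.
(* the energy at which the Sobolev inequality gives exactly eps *)
pose e0 : R := eps `^ (2 / q) / CS.
have e00 : 0 < e0 by rewrite divr_gt0 ?powR_gt0.
pose L : R := 8 * (M + 1) / (cns n s * e0).
have M1 : 0 < M + 1 by rewrite ltr_wpDl.
have ce0 : 0 < cns n s * e0 by exact: mulr_gt0.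
have L0 : 0 < L by rewrite divr_gt0// mulr_gt0.
have [C3 C30 H3] := kenergy_frac_le_log L0.
pose eta : R := e0 / (2 * (C3 + 1)).
have C31 : 0 < C3 + 1 by rewrite ltr_wpDl.
have eta0 : 0 < eta by rewrite divr_gt0// mulr_gt0.
have MC1 : 0 <= C1 * M by rewrite mulr_ge0// ltW.
have MC2 : 0 <= C2 * M by rewrite mulr_ge0.
have EF k : (kenergy (kernel_frac s) (u_ k) <= (C1 * M)%:E)%E.
  apply: (le_trans (H1 _ (mu_ k) (zu_ k))).
  by rewrite EFinM lee_wpmul2l// lee_fin ltW.
have I2 k : (\int[mu]_x (u_ k x ^+ 2)%:E <= (C2 * M)%:E)%E.
  apply: (le_trans (H2 _ (mu_ k) (zu_ k))).
  by rewrite EFinM lee_wpmul2l// lee_fin.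
have [B [uB BA HB]] := @mean_square_precompact R n s n0 s0 Omega (C1 * M) (C2 * M) u_
  bO MC1 MC2 mu_ zu_ EF I2 eta A eta0 uA.
exists B; split => // k l Bk Bl.
have mB : measurable_fun setT (fun x => u_ k x - u_ l x) by exact: measurable_funB.
have -> : eps = (CS * e0) `^ (q / 2).
  rewrite /e0 mulrC divfK ?gt_eqF// -powRrM.
  rewrite (_ : 2 / q * (q / 2) = 1) ?powRr1 ?(ltW eps0)//.
  by field; rewrite gt_eqF.
apply: HS => //.
- by apply: (le_lt_trans (HB k l Bk Bl)); exact: ltry.
- exact: ltW.
apply: (le_trans (H3 _ mB)).
have cL : 0 < cns n s * L by exact: mulr_gt0.
have cL0 : 0 < (cns n s * L)^-1 by rewrite invr_gt0.
have E4 : (kenergy (kernel_log s) (fun x => (u_ k x - u_ l x)%R) <= (4 * M)%:E)%E.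
  apply: (le_trans (kenergyB_le _ _ (mu_ k) (mu_ l))).
  - by move=> z; exact: kernel_log_ge0.
  - exact: measurable_kernel_log.
  have -> : 4 * M = 2 * M + 2 * M by ring.
  by rewrite [leRHS]EFinD; apply: leeD; rewrite EFinM lee_pmul2l// lte_fin.
have D1 : (cns n s * L)^-1 * (4 * M) <= e0 / 2.
  rewrite mulrC ler_pdivrMr//.
  have -> : e0 / 2 * (cns n s * L) = 4 * (M + 1).
    have cn : cns n s != 0 by rewrite gt_eqF.
    have en : e0 != 0 by rewrite gt_eqF.
    by rewrite /L; field; rewrite ?en ?cn.
  by rewrite ler_pM2l// lerDl.
have D2 : C3 * eta <= e0 / 2.
  have -> : C3 * eta = e0 / 2 * (C3 / (C3 + 1)).
    by rewrite /eta; field; rewrite gt_eqF.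
  apply: ler_piMr; first by apply: divr_ge0 => //; exact: ltW.
  by rewrite ler_pdivrMr// mul1r lerDl.
apply: (@le_trans _ _ (e0 / 2 + e0 / 2)%:E); last by rewrite -splitr.
rewrite [leRHS]EFinD; apply: leeD.
  apply: (@le_trans _ _ ((cns n s * L)^-1 * (4 * M))%:E); last by rewrite lee_fin.
  by rewrite EFinM lee_wpmul2l// lee_fin ltW.
apply: (@le_trans _ _ (C3 * eta)%:E); last by rewrite lee_fin.
by rewrite EFinM lee_wpmul2l ?lee_fin// HB.
Qed.

End logarithmic_energy.

(** * Inclusions and compact embedding *)
Section norms.
Context {R : realType}.

Lemma le_sqrt_energy (C : R) (E1 E2 : \bar R) : 0 <= C -> (0 <= E1)%E -> (0 <= E2)%E ->
  (E1 <= C%:E * E2)%E -> (E1 `^ 2^-1 <= (C `^ 2^-1)%:E * E2 `^ 2^-1)%E.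
Proof.
move=> C0 E10 E20 H; rewrite -poweR_EFin -poweRM//.
by apply: gt0_ler_poweR; rewrite ?in_itv/= ?leey ?andbT ?mule_ge0.
Qed.

Lemma energy_lty (E : \bar R) : (E `^ 2^-1 < +oo)%E -> (E < +oo)%E.
Proof. by move=> /lty_poweRy; apply; rewrite invr_eq0 pnatr_eq0. Qed.

Lemma energy_le_of_sqrt (E : \bar R) (M : R) : (0 <= E)%E -> 0 <= M ->
  (E `^ 2^-1 <= M%:E)%E -> (E <= (M ^+ 2)%:E)%E.
Proof.
move=> E0 M0 H; rewrite -[leLHS]poweRe1//.
have {1}-> : 1 = 2^-1 * 2 :> R by rewrite mulVf.
rewrite poweRrM -powR_mulrn// -poweR_EFin.
by apply: gt0_ler_poweR => //; rewrite in_itv/= leey andbT ?poweR_ge0 ?lee_fin.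
Qed.

Lemma powR_le_sum (q a b c : R) : 0 <= q -> 0 <= a -> 0 <= b -> 0 <= c -> a <= b + c ->
  a `^ q <= 2 `^ q * b `^ q + 2 `^ q * c `^ q.
Proof.
move=> q0 a0 b0 c0 abc; rewrite -!powRM//.
have [bc|cb] := leP b c.
  rewrite ler_wpDl ?powR_ge0//; apply: ge0_ler_powR; rewrite ?nnegrE ?mulr_ge0//; lra.
by rewrite ler_wpDr ?powR_ge0//; apply: ge0_ler_powR; rewrite ?nnegrE ?mulr_ge0//; lra.
Qed.

End norms.

Section Lfun_facts.
Context d (T : measurableType d) (R : realType) (mu : {measure set T -> \bar R}).

Lemma Lfun_measurable (p : \bar R) (u : T -> R) :
  u \in Lfun mu p -> measurable_fun setT u.
Proof. by move=> /sub_Lfun_mfun; rewrite inE. Qed.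

Lemma mem_Lfun (p : \bar R) (u : T -> R) : measurable_fun setT u ->
  ('N[mu]_p[EFin \o u] < +oo)%E -> u \in Lfun mu p.
Proof. by move=> mu0 Nu; apply/andP; rewrite !inE. Qed.

Lemma Lfun2 (u : T -> R) : measurable_fun setT u ->
  (\int[mu]_x (u x ^+ 2)%:E < +oo)%E -> u \in Lfun mu 2%:E.
Proof.
move=> mu0 Iu; apply: mem_Lfun => //; rewrite unlock; apply: poweR_lty.
rewrite (eq_integral (fun x => (u x ^+ 2)%:E))// => x _ /=.
by rewrite powR_mulrn// real_normK// num_real.
Qed.

Lemma Lfun2_lty (u : T -> R) : u \in Lfun mu 2%:E ->
  (\int[mu]_x (u x ^+ 2)%:E < +oo)%E.
Proof.
move=> /sub_Lfun_finLfun; rewrite inE /= /finite_norm unlock.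
rewrite (eq_integral (fun x => (u x ^+ 2)%:E))//; last first.
  by move=> x _ /=; rewrite powR_mulrn// real_normK// num_real.
by move=> /lty_poweRy; apply; rewrite invr_eq0 pnatr_eq0.
Qed.

End Lfun_facts.

Section embeddings.
Context {R : realType} (n : nat) (s : R) (Omega : set 'rV[R]_n).
Hypotheses (n0 : (0 < n)%N) (s01 : 0 < s < 1).
Hypotheses (bO : bounded_set Omega) (oO : open Omega).
Local Notation V := 'rV[R]_n.
Local Notation mu := (lebesgue_rV R n).

Let s0 : 0 < s. Proof. by case/andP: s01. Qed.
Let c0 : 0 < cns n s. Proof. exact: cns_gt0. Qed.
Let mO : measurable Omega. Proof. exact: open_measurable_rV. Qed.

Let E0 (u : V -> R) : (0 <= kenergy (kernel_log s) u)%E.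
Proof. by apply: kenergy_ge0 => z; exact: kernel_log_ge0. Qed.

Let F0 sigma (u : V -> R) : (0 <= kenergy (kernel_frac sigma) u)%E.
Proof. by apply: kenergy_ge0 => z; exact: kernel_frac_ge0. Qed.

Lemma H_frac_sub_H_log eps : 0 < eps ->
  continuously_included (H_frac (s + eps) Omega) (H_log s Omega).
Proof.
move=> e0; have C0 : 0 <= cns n s / (2 * eps).
  by apply: divr_ge0; [exact: ltW|rewrite mulr_ge0// ltW].
have [CP CP0 HP] := poincare_log n0 s01 bO.
have H := kenergy_log_le_frac (n := n) s01 e0; split => [u [mu0 zu Nu]|].
  have Elog : (kenergy (kernel_log s) u < +oo)%E.
    apply: (le_lt_trans (H u mu0)); apply: lte_mul_pinfty => //.
    exact: energy_lty.
  split => //; last exact: poweR_lty.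
  apply: Lfun2 => //; apply: (le_lt_trans (HP u mu0 zu)).
  exact: lte_mul_pinfty.
exists ((cns n s / (2 * eps)) `^ 2^-1) => u [mu0 _ _].
by apply: le_sqrt_energy => //; exact: H.
Qed.

Lemma H_log_sub_H_frac : continuously_included (H_log s Omega) (H_frac s Omega).
Proof.
have [C C0 H] := kenergy_frac_le_log_bounded n0 s01 bO.
split => [u [/Lfun_measurable mu0 Nu zu]|].
  split => //; apply: poweR_lty; apply: (le_lt_trans (H u mu0 zu)).
  apply: lte_mul_pinfty => //; first by rewrite lee_fin ltW.
  exact: energy_lty.
exists (C `^ 2^-1) => u [/Lfun_measurable mu0 _ zu].
by apply: le_sqrt_energy => //; [exact: ltW|exact: H].
Qed.

Hypothesis sn : 2 * s < n%:R.
Local Notation q := (sobolev_exponent n s).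
Let q2 : 2 < q. Proof. exact: sobolev_exponent_gt2. Qed.
Let q1 : 1 <= q. Proof. by rewrite (le_trans _ (ltW q2))// ler1n. Qed.
Let q0 : 0 < q. Proof. exact: lt_le_trans q1. Qed.

Lemma restrict_vanishes (u : V -> R) : vanishes_outside Omega (u \_ Omega).
Proof. by move=> x Ox; rewrite patchE memNset. Qed.

Lemma measurable_restrictR (u : V -> R) : measurable_fun setT u ->
  measurable_fun setT (u \_ Omega).
Proof.
by move=> mu0; apply/(measurable_restrictT _ _).1 => //; exact: measurable_funTS.
Qed.

Lemma lebesgue_bounded_le : exists2 b : R, 0 <= b & (mu Omega <= b%:E)%E.
Proof.
have [K K0 OK] := bounded_set_ccube bO; exists ((2 * K) ^+ n).
  by rewrite exprn_ge0// mulr_ge0// ltW.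
rewrite -(lebesgue_ccube (0 : V) (ltW K0)).
by apply: le_measure => //; rewrite inE//; exact: measurable_ccube.
Qed.

(** The norm is returned as a real number [t], so that [Lnorm_le] can be applied with
    [C * t]. *)
Lemma H_log_critical_bound : exists2 C : R, 0 <= C & forall u,
  fcarrier (H_log s Omega) u -> exists2 t : R, 0 <= t &
    norm_log s u = t%:E /\ (\int[mu]_x (`|u x| `^ q)%:E <= ((C * t) `^ q)%:E)%E.
Proof.
have [C1 C10 H1] := kenergy_frac_le_log_bounded n0 s01 bO.
have [CS CS0 HS] := sobolev n0 s01 sn.
have C0 : 0 <= CS * C1 by rewrite mulr_ge0// ltW.
exists ((CS * C1) `^ 2^-1); first exact: powR_ge0.
move=> u [L2u Nu zu]; have mu0 := Lfun_measurable L2u.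
have Efin : kenergy (kernel_log s) u \is a fin_num.
  by rewrite ge0_fin_numE//; exact: energy_lty.
pose e := fine (kenergy (kernel_log s) u).
have eE : kenergy (kernel_log s) u = e%:E by rewrite fineK.
have e0 : 0 <= e by rewrite fine_ge0.
exists (e `^ 2^-1); first exact: powR_ge0.
split; first by rewrite /norm_log eE poweR_EFin.
have -> : ((CS * C1) `^ 2^-1 * e `^ 2^-1) `^ q = (CS * (C1 * e)) `^ (q / 2).
  by rewrite -powRM// -powRrM mulrA [2^-1 * _]mulrC.
apply: HS => //; first exact: Lfun2_lty.
  by rewrite mulr_ge0// ltW.
by rewrite EFinM -eE; exact: H1.
Qed.

Lemma H_log_sub_Lp p : 1 <= p <= q ->
  continuously_included (H_log s Omega) (Lp_on p Omega).
Proof.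
move=> /andP[p1 pq]; have p0 : 0 < p by exact: lt_le_trans p1.
have [b b0 muO] := lebesgue_bounded_le.
have [C C0 HC] := H_log_critical_bound.
have key u : fcarrier (H_log s Omega) u ->
    ('N[mu]_p%:E[EFin \o (u \_ Omega)] <= (C * (1 + b) `^ p^-1)%:E * norm_log s u)%E.
  move=> Hu; have [t t0 [Nu Iu]] := HC u Hu.
  have mu0 : measurable_fun setT u by case: Hu => /Lfun_measurable.
  rewrite Nu -EFinM mulrAC.
  apply: (Lnorm_le mO b0 muO q1 p0 pq (mulr_ge0 C0 t0)
    (measurable_restrictR mu0) (@restrict_vanishes u)).
  apply: le_trans Iu; apply: le_integral_EFin => //.
  - by apply: measurable_normr_powR; exact: measurable_restrictR.
  - exact: measurable_normr_powR.
  move=> x _; rewrite patchE; case: ifPn => // _.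
  by rewrite normr0 powR0 ?powR_ge0// gt_eqF.
split; last by exists (C * (1 + b) `^ p^-1).
move=> u Hu; apply: mem_Lfun.
  by apply: measurable_restrictR; case: Hu => /Lfun_measurable.
apply: (le_lt_trans (key u Hu)); have [t t0 [-> _]] := HC u Hu.
by rewrite -EFinM ltry.
Qed.

(** Pairwise distances at most [2 ^ (- i)] in [L ^ q] are extracted for every [i],
    then diagonally; the limit in [L ^ q] is a limit in [L ^ p]. *)
Lemma H_log_compact_Lp p : 1 <= p <= q ->
  compactly_embedded (H_log s Omega) (Lp_on p Omega).
Proof.
move=> pq; split; first exact: H_log_sub_Lp.
move: pq => /andP[p1 pq]; have p0 : 0 < p by exact: lt_le_trans p1.
move=> u_ Hu [M HM].
have [b b0 muO] := lebesgue_bounded_le.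
have [C C0 HC] := H_log_critical_bound.
have mu_ k : measurable_fun setT (u_ k) by case: (Hu k) => /Lfun_measurable.
have zu_ k : zero_outside Omega (u_ k) by case: (Hu k).
have M0 : 0 <= M by rewrite -lee_fin; apply: le_trans (HM 0%N); exact: poweR_ge0.
have EM k : (kenergy (kernel_log s) (u_ k) <= (M ^+ 2)%:E)%E.
  by apply: energy_le_of_sqrt => //; exact: HM.
have h0 i : 0 < 2^-1 ^+ i :> R by rewrite exprn_gt0// invr_gt0.
have [phi [phi_lt Hphi]] := @diagonal_subsequence
  (fun i k l => (\int[mu]_x (`|u_ k x - u_ l x| `^ q)%:E <= ((2^-1 ^+ i) `^ q)%:E)%E)
  (fun i A uA => critical_precompact n0 s01 bO sn (sqr_ge0 M) mu_ zu_ EM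
     (powR_gt0 q (h0 i)) uA).
exists phi; split => //.
pose w k := u_ (phi k) \_ Omega.
have mw k : measurable_fun setT (w k) by exact: measurable_restrictR.
have wO k : vanishes_outside Omega (w k) by exact: restrict_vanishes.
have cw i k l : (i <= k)%N -> (i <= l)%N ->
    (\int[mu]_x (`|w k x - w l x| `^ q)%:E <= ((2^-1 ^+ i) `^ q)%:E)%E.
  move=> ik il; apply: le_trans (Hphi i k l ik il); apply: le_integral_EFin => //.
  - by apply: measurable_normr_powR; exact: measurable_funB.
  - by apply: measurable_normr_powR; exact: measurable_funB.
  move=> x _; rewrite /w !patchE; case: ifPn => // _.
  by rewrite subrr normr0 powR0 ?powR_ge0// gt_eqF.
have [v [mv vO Hv]] := fast_cauchy_limit mO b0 muO q1 mw wO cw.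
have vE : v \_ Omega = v.
  apply/funext => x; rewrite patchE; case: ifPn => //.
  by rewrite notin_setE => /vO ->.
exists v.
  rewrite /= vE; apply: mem_Lfun => //.
  have [t t0 [_ It]] := HC _ (Hu (phi 0%N)).
  pose r : R := 2 `^ q * (C * t) `^ q + 2 `^ q * (2^-1 ^+ 0) `^ q.
  have r0 : 0 <= r by rewrite addr_ge0// mulr_ge0 ?powR_ge0.
  have Iv : (\int[mu]_x (`|v x| `^ q)%:E <= ((r `^ q^-1) `^ q)%:E)%E.
    rewrite -powRrM mulVf ?powRr1 ?gt_eqF//.
    apply: (@le_trans _ _ ((2 `^ q)%:E * \int[mu]_x (`|w 0%N x| `^ q)%:E +
       (2 `^ q)%:E * \int[mu]_x (`|w 0%N x - v x| `^ q)%:E)%E).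
      apply: (@le_integral_lin _ _ R mu setT (2 `^ q) (2 `^ q) (fun x => `|v x| `^ q)
        (fun x => `|w 0%N x| `^ q) (fun x => `|w 0%N x - v x| `^ q)) => //;
      try exact: powR_ge0; try exact: measurable_normr_powR;
      try (by move=> x; exact: powR_ge0).
        by apply: measurable_normr_powR; exact: measurable_funB.
      move=> x _; apply: powR_le_sum => //; first exact: ltW.
      by rewrite -{1}(subKr (w 0%N x) (v x)) ler_normB.
    have q20 : (0 <= (2 `^ q)%:E)%E by rewrite lee_fin powR_ge0.
    rewrite [leRHS]EFinD; apply: leeD; rewrite EFinM; apply: (lee_wpmul2l q20); last first.
      exact: Hv.
    apply: le_trans It; apply: le_integral_EFin => //.
    - exact: measurable_normr_powR.
    - exact: measurable_normr_powR.
    move=> x _; rewrite /w patchE; case: ifPn => // _.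
    by rewrite normr0 powR0 ?powR_ge0// gt_eqF.
  apply: (le_lt_trans (Lnorm_le mO b0 muO q1 p0 pq (powR_ge0 _ _) mv vO Iv)).
  exact: ltry.
have Nle k : ('N[mu]_p%:E[EFin \o ((fun x => (u_ (phi k) x - v x)%R) \_ Omega)] <=
    (2^-1 ^+ k * (1 + b) `^ p^-1)%:E)%E.
  rewrite (_ : _ \_ Omega = fun x => w k x - v x).
    apply: (Lnorm_le mO b0 muO q1 p0 pq) => //.
      exact: measurable_funB.
    by move=> x Ox; rewrite wO// vO// subrr.
  apply/funext => x; rewrite /w !patchE; case: ifPn => //.
  by rewrite notin_setE => /vO ->; rewrite subrr.
apply: (@squeeze_cvge _ _ _ _ (cst 0%E) _
  (fun k => (2^-1 ^+ k * (1 + b) `^ p^-1)%:E)).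
- by apply: nearW => k; rewrite /= Lnorm_ge0 Nle.
- exact: cvg_cst.
apply: cvg_EFin; first exact: nearW.
rewrite -(mul0r ((1 + b) `^ p^-1)); apply: cvgM; last exact: cvg_cst.
apply: cvg_expr; rewrite ger0_norm ?invr_ge0// invf_lt1// ltr1n.
by [].
Qed.

End embeddings.

Theorem proposition1p6 (R : realType) (n : nat) (s : R)
    (Omega : set 'rV[R]_n) :
  (1 <= n)%N -> 0 < s < 1 -> 2 * s < n%:R ->
  bounded_lipschitz_domain Omega ->
  (forall eps : R, 0 < eps < 1 - s ->
     continuously_included (H_frac (s + eps) Omega) (H_log s Omega) /\
     continuously_included (H_log s Omega) (H_frac s Omega)) /\
  (forall p : R, 1 <= p <= 2 * n%:R / (n%:R - 2 * s) ->
     compactly_embedded (H_log s Omega) (Lp_on p Omega)).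
Proof.
move=> n1 s01 sn [_ oO _ bO _]; split => [eps /andP[eps0 _]|p pq].
  by split; [exact: H_frac_sub_H_log|exact: H_log_sub_H_frac].
exact: H_log_compact_Lp.
Qed.
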